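(* For every even integer $n\ge 6$, the $\mathcal{S}_n$-lattice $\mathsf{Sym}^2 A_{n-1}$ is not equivalent (in the sense of $\sim$) to a direct summand of a quasi-permutation $\mathcal{S}_n$-lattice. Moreover, $\bigwedge^2A_{n-1}\not\sim A_{n-1}^{\otimes 2}$.
   Context: $\mathcal{S}_n$ is the symmetric group on $\{1,\ldots,n\}$. $A_{n-1}=\{(z_1,\ldots,z_n)\in\mathbb{Z}^n\mid\sum_i z_i=0\}$ with $\mathcal{S}_n$ permuting the coordinates of $\mathbb{Z}^n$. For a finite group $\mathcal{G}$, a $\mathcal{G}$-lattice is a $\mathbb{Z}[\mathcal{G}]$-module that is free of finite rank over $\mathbb{Z}$; a permutation $\mathcal{G}$-lattice is one having a $\mathbb{Z}$-basis permuted by $\mathcal{G}$. For a $\mathcal{G}$-lattice $M$, $M^{\otimes 2}=M\otimes_{\mathbb{Z}}M$ with diagonal action; $\mathsf{Sym}^2M$ is the quotient of $M^{\otimes 2}$ by the subgroup generated by all $m\otimes m'-m'\otimes m$; $\bigwedge^2M$ is the quotient of $M^{\otimes 2}$ by the subgroup generated by all $m\otimes m$; both are $\mathcal{G}$-lattices with the induced action. Two $\mathcal{G}$-lattices $M,N$ are equivalent, $M\sim N$, if there are exact sequences of $\mathcal{G}$-lattices $0\to M\to E\to P\to 0$ and $0\to N\to E\to Q\to 0$ (same $E$) with $P,Q$ permutation $\mathcal{G}$-lattices. A $\mathcal{G}$-lattice $M$ is quasi-permutation if $M\sim 0$, i.e. if there is an exact sequence of $\mathcal{G}$-lattices $0\to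 M\to P\to Q\to 0$ with $P,Q$ permutation $\mathcal{G}$-lattices. *)

(* Defs.v *)
From HB Require Import structures.
From mathcomp Require Import all_boot all_order all_algebra all_fingroup.
From mathcomp Require Import boolp.
From mathcomp Require Import ring.
From mathcomp.multinomials Require Import freeg.
Set Implicit Arguments.
Unset Strict Implicit.
Unset Printing Implicit Defensive.
Import Order.TTheory GRing.Theory Num.Theory.
Local Open Scope ring_scope.
Local Open Scope quotient_scope.

Definition zcomb (V : zmodType) (I : finType) (b : I -> V)
  (c : {ffun I -> int}) : V := \sum_i b i *~ c i.

Definition zbasis (V : zmodType) (I : finType) (b : I -> V) : Prop :=
  forall x : V, exists! c : {ffun I -> int}, x = zcomb b c.

Lemma zcombB (V : zmodType) (I : finType) (b : I -> V) c d :
  zcomb b (c - d) = zcomb b c - zcomb b d.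
Proof.
by rewrite /zcomb -sumrB; apply: eq_bigr => i _; rewrite !ffunE mulrzBr.
Qed.

Definition zdelta (I : finType) (i : I) : {ffun I -> int} :=
  [ffun j => (i == j)%:Z].

Lemma zcomb_delta (V : zmodType) (I : finType) (b : I -> V) i :
  zcomb b (zdelta i) = b i.
Proof.
rewrite /zcomb (bigD1 i) //= ffunE eqxx big1 ?addr0 ?mulr1z // => j ji.
by rewrite ffunE eq_sym (negbTE ji).
Qed.

Lemma zbasis_coord (V : zmodType) (I : finType) (b : I -> V) : zbasis b ->
  exists c : {additive V -> {ffun I -> int}},
    (forall x, zcomb b (c x) = x) /\ (forall i, c (b i) = zdelta i).
Proof.
move=> bV; have [c cE] : {c : V -> {ffun I -> int} | forall x, x = zcomb b (c x)}.
  by exists (fun x => projT1 (cid (bV x))) => x; case: cid => c [].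
have cU x d : x = zcomb b d -> c x = d.
  by move=> xd; have [e [_ eU]] := bV x; rewrite -(eU _ (cE x)) -(eU _ xd).
have cB : zmod_morphism c.
  by move=> x y; apply: cU; rewrite zcombB -!cE.
pose cA := GRing.isZmodMorphism.Build _ _ c cB.
exists (HB.pack_for {additive V -> {ffun I -> int}} c cA).
by split=> [x|i]; [rewrite /= -cE | apply: cU; rewrite zcomb_delta].
Qed.

Lemma coord_zcomb (V : zmodType) (I : finType) (b : I -> V)
    (c : {additive V -> {ffun I -> int}}) :
  (forall i, c (b i) = zdelta i) -> forall d, c (zcomb b d) = d.
Proof.
move=> cb d; rewrite raddf_sum; apply/ffunP => j.
rewrite sum_ffunE (bigD1 j) //= raddfMz cb ffunMzE ffunE eqxx big1 => [|i ij].
  by rewrite addr0 intz.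
by rewrite raddfMz cb ffunMzE ffunE (negbTE ij) mul0rz.
Qed.

Lemma zbasis_of_coord (V : zmodType) (I : finType) (b : I -> V)
    (c : {additive V -> {ffun I -> int}}) :
    (forall i, c (b i) = zdelta i) ->
    (forall x, exists d, x = zcomb b d) -> zbasis b.
Proof.
move=> /coord_zcomb cz bV x.
have [d xd] := bV x; exists d; split=> // e xe.
by rewrite -(cz d) -xd xe cz.
Qed.

Lemma zcomb_closed (V : zmodType) (I : finType) (b : I -> V) :
  zmod_closed [pred x | `[< exists d, x = zcomb b d >]].
Proof.
split=> [|x y]; rewrite !inE.
  by apply/asboolP; exists (0 - 0); rewrite zcombB subrr.
move=> /asboolP [d ->] /asboolP [e ->]; apply/asboolP.
by exists (d - e); rewrite zcombB.
Qed.

Definition zfree (V : zmodType) : Prop :=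
  exists (I : finType) (b : I -> V), zbasis b.

(* Z[G]-modules are given as abelian groups with an additive right G-action,
   the action convention of the library.  As the product of permutations is
   (s * t) i = t (s i), a right module over {perm T} is exactly a left module
   over the symmetric group with the usual composition of maps as product. *)
Record gmodule (gT : finGroupType) := GModule {
  gmod_sort :> zmodType;
  gact : gmod_sort -> gT -> gmod_sort;
  gact1 : forall x, gact x 1%g = x;
  gactM : forall x g h, gact x (g * h)%g = gact (gact x g) h;
  gactD : forall x y g, gact (x + y) g = gact x g + gact y g
}.

Record glattice (gT : finGroupType) := GLattice {
  lat_mod :> gmodule gT;
  lat_free : zfree lat_mod
}.

Definition equivariant (gT : finGroupType) (M N : gmodule gT) (f : M -> N) :=
  forall x g, f (gact x g) = gact (f x) g.

Definition permutation_lattice (gT : finGroupType) (M : glattice gT) : Prop :=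
  exists (I : finType) (b : I -> M),
    zbasis b /\ forall i g, exists j, gact (b i) g = b j.

(* There is an exact sequence 0 -> M -> E -> P -> 0 of G-modules. *)
Definition short_exact (gT : finGroupType) (M E P : gmodule gT) : Prop :=
  exists (f : {additive M -> E}) (p : {additive E -> P}),
    [/\ equivariant f, equivariant p, injective f,
        (forall z, exists y, p y = z)
      & forall y, p y = 0 <-> exists x, f x = y].

Definition lat_equiv (gT : finGroupType) (M N : glattice gT) : Prop :=
  exists E P Q : glattice gT,
    [/\ permutation_lattice P, permutation_lattice Q,
        short_exact M E P & short_exact N E Q].

Definition quasi_permutation (gT : finGroupType) (M : glattice gT) : Prop :=
  exists P Q : glattice gT,
    [/\ permutation_lattice P, permutation_lattice Q & short_exact M P Q].

(* N is a direct summand of M: for some N', M is isomorphic to N (+) N'. *)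
Definition direct_summand (gT : finGroupType) (N M : glattice gT) : Prop :=
  exists (N' : glattice gT) (f : {additive (N * N')%type -> M}),
    bijective f /\
    forall x x' g, f (gact x g, gact x' g) = gact (f (x, x')) g.

Lemma zmod_closed_comb (V : zmodType) (H : {pred V}) (I : Type) (r : seq I)
    (F : I -> V) (m : I -> int) :
  zmod_closed H -> (forall i, F i \in H) -> \sum_(i <- r) F i *~ m i \in H.
Proof.
move=> [H0 HB] HF.
have HN y : y \in H -> - y \in H by rewrite -sub0r; exact: HB.
have HD y z : y \in H -> z \in H -> y + z \in H.
  by move=> Hy Hz; rewrite -[z]opprK; apply: HB => //; exact: HN.
apply: (big_ind (fun y => y \in H)) => // i _.
have Hn n : F i *+ n \in H by elim: n => [|n IHn] //; rewrite mulrS HD.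
by case: (m i) => n; rewrite ?NegzE ?mulrNz -?pmulrn ?HN // Hn.
Qed.

Section GeneratedSubgroup.
Variables (V : zmodType) (S : V -> Prop).

Definition gen_subgroup : {pred V} := [pred x | `[< forall H : {pred V},
  zmod_closed H -> (forall s, S s -> s \in H) -> x \in H >]].

Lemma gen_subgroupP x : reflect (forall H : {pred V}, zmod_closed H ->
  (forall s, S s -> s \in H) -> x \in H) (x \in gen_subgroup).
Proof. exact: (iffP (asboolP _)). Qed.

Fact gen_subgroup_closed : zmod_closed gen_subgroup.
Proof.
split=> [|x y /gen_subgroupP Sx /gen_subgroupP Sy].
  by apply/gen_subgroupP=> H [].
apply/gen_subgroupP=> H clH SH; have [_ HB] := clH.
by apply: HB; [exact: Sx | exact: Sy].
Qed.
HB.instance Definition _ :=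
  GRing.isZmodClosed.Build V gen_subgroup gen_subgroup_closed.

Lemma mem_gen_subgroup s : S s -> s \in gen_subgroup.
Proof. by move=> Ss; apply/gen_subgroupP=> H _; apply. Qed.

Lemma gen_subgroup_ker (W : zmodType) (h : {additive V -> W}) :
  (forall s, S s -> h s = 0) -> forall x, x \in gen_subgroup -> h x = 0.
Proof.
move=> hS x /gen_subgroupP /(_ [pred y | h y == 0]) xP.
apply/eqP; apply: xP => [|s Ss]; last by rewrite inE hS.
split=> [|y z]; rewrite !inE ?raddf0 // => /eqP hy /eqP hz.
by rewrite raddfB hy hz subrr.
Qed.

Definition gen_quot : zmodType := Quotient.quot gen_subgroup.

Definition gen_proj (x : V) : gen_quot := \pi_(Quotient.quot gen_subgroup) x.

Fact gen_proj_additive : zmod_morphism gen_proj.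
Proof. by move=> x y; exact: (raddfB \pi_(Quotient.quot gen_subgroup)). Qed.
HB.instance Definition _ :=
  GRing.isZmodMorphism.Build V gen_quot gen_proj gen_proj_additive.

Definition gen_repr (q : gen_quot) : V :=
  generic_quotient.repr (q : Quotient.quot gen_subgroup).

Lemma gen_reprK : cancel gen_repr gen_proj.
Proof. exact: reprK. Qed.

Lemma gen_proj_surj (q : gen_quot) : exists x, gen_proj x = q.
Proof. by exists (gen_repr q); exact: gen_reprK. Qed.

Lemma gen_proj_eq x y : gen_proj x = gen_proj y <-> x - y \in gen_subgroup.
Proof.
rewrite [x - y \in _]Quotient.idealrBE.
by split=> [/eqP|/eqP].
Qed.

Lemma gen_quot_lift (W : zmodType) (h : {additive V -> W}) :
  (forall s, S s -> h s = 0) ->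
  exists h' : {additive gen_quot -> W}, forall x, h' (gen_proj x) = h x.
Proof.
move=> hS; pose h' (q : gen_quot) := h (gen_repr q).
have h'E x : h' (gen_proj x) = h x.
  apply/eqP; rewrite -subr_eq0 -raddfB; apply/eqP.
  apply: (gen_subgroup_ker hS); apply/gen_proj_eq; exact: gen_reprK.
have h'B : zmod_morphism h'.
  move=> q r; have [x <-] := gen_proj_surj q; have [y <-] := gen_proj_surj r.
  by rewrite -raddfB !h'E raddfB.
pose hM := GRing.isZmodMorphism.Build _ _ h' h'B.
by exists (HB.pack_for {additive gen_quot -> W} h' hM).
Qed.

End GeneratedSubgroup.

Section ActionMorphism.
Variables (gT : finGroupType) (M : gmodule gT).

Definition gact_by (g : gT) (x : M) : M := gact x g.

Fact gact_by_additive g : zmod_morphism (gact_by g).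
Proof.
move=> x y; apply/eqP; rewrite eq_sym subr_eq -gactD.
by rewrite subrK.
Qed.
HB.instance Definition _ g :=
  GRing.isZmodMorphism.Build M M (gact_by g) (gact_by_additive g).

Lemma gactB x y g : gact (x - y : M) g = gact x g - gact y g.
Proof. exact: (raddfB (gact_by g)). Qed.

End ActionMorphism.

Section QuotientModule.
Variables (gT : finGroupType) (M : gmodule gT) (S : M -> Prop).
Hypothesis S_stable : forall s g, S s -> S (gact s g).

Definition quot_act (q : gen_quot S) (g : gT) : gen_quot S :=
  gen_proj S (gact (gen_repr q) g).

Fact quot_act_proj x g : quot_act (gen_proj S x) g = gen_proj S (gact x g).
Proof.
apply/gen_proj_eq.
pose h : {additive M -> gen_quot S} := gen_proj S \o gact_by g.
have hS s : S s -> h s = 0.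
  move=> Ss; rewrite -(raddf0 (gen_proj S)); apply/gen_proj_eq.
  by rewrite subr0; exact/mem_gen_subgroup/S_stable.
apply/gen_proj_eq/eqP; rewrite -subr_eq0; apply/eqP.
rewrite -[LHS](raddfB h); apply: (gen_subgroup_ker hS); apply/gen_proj_eq.
exact: gen_reprK.
Qed.

Fact quot_act1 q : quot_act q 1%g = q.
Proof.
have [x <-] := gen_proj_surj q.
by rewrite quot_act_proj gact1.
Qed.

Fact quot_actM q g h : quot_act q (g * h)%g = quot_act (quot_act q g) h.
Proof.
have [x <-] := gen_proj_surj q.
by rewrite !quot_act_proj gactM.
Qed.

Fact quot_actD q r g : quot_act (q + r) g = quot_act q g + quot_act r g.
Proof.
have [x <-] := gen_proj_surj q; have [y <-] := gen_proj_surj r.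
by rewrite -raddfD !quot_act_proj gactD raddfD.
Qed.

Definition quot_gmodule : gmodule gT :=
  GModule quot_act1 quot_actM quot_actD.

End QuotientModule.

Section FreegLift.
Variables (K : choiceType) (W : zmodType) (f : K -> W).

Definition freeg_lift_fun (x : {freeg K}) : W :=
  fglift (M := zmodule W) f x.

Fact freeg_lift_additive : zmod_morphism freeg_lift_fun.
Proof. exact: (lift_is_additive (M := zmodule W)). Qed.
HB.instance Definition _ :=
  GRing.isZmodMorphism.Build {freeg K} W freeg_lift_fun freeg_lift_additive.

Definition freeg_lift : {additive {freeg K} -> W} := freeg_lift_fun.

Lemma freeg_liftU k : freeg_lift << k >> = f k.
Proof. by rewrite /= /freeg_lift_fun liftU scale1r. Qed.

End FreegLift.

Section FreeModule.
Variables (gT : finGroupType) (K : choiceType) (to : K -> gT -> K).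
Hypotheses (to1 : forall k, to k 1%g = k)
  (toM : forall k g h, to k (g * h)%g = to (to k g) h).

Definition free_push (g : gT) : {additive {freeg K} -> {freeg K}} :=
  freeg_lift (fun k => << to k g >>).

Lemma free_pushU k g : free_push g << k >> = << to k g >>.
Proof. by rewrite freeg_liftU. Qed.

Lemma freeg_ind_add (W : zmodType) (f h : {additive {freeg K} -> W}) :
  (forall k, f << k >> = h << k >>) -> f =1 h.
Proof.
move=> fh x; rewrite -[x]freeg_sumE !raddf_sum; apply: eq_bigr => k _.
by rewrite -[coeff k x]intz -freegU_mulz !raddfMz fh.
Qed.

Fact free_act1 x : free_push 1%g x = x.
Proof.
move: x; apply: (@freeg_ind_add _ (free_push 1%g) idfun) => k.
by rewrite free_pushU to1.
Qed.

Fact free_actM x g h : free_push (g * h)%g x = free_push h (free_push g x).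
Proof.
move: x; apply: (@freeg_ind_add _ (free_push (g * h)%g)
                   (free_push h \o free_push g)) => k.
by rewrite [RHS]/= !free_pushU toM.
Qed.

Definition free_gmodule : gmodule gT :=
  @GModule gT {freeg K} (fun x g => free_push g x) free_act1 free_actM
    (fun x y g => raddfD (free_push g) x y).

End FreeModule.

Section TensorSquare.
Variables (gT : finGroupType) (M : gmodule gT).

Definition diag_act (z : M * M) (g : gT) : M * M :=
  (gact z.1 g, gact z.2 g).

Fact diag_act1 z : diag_act z 1%g = z.
Proof. by case: z => x y; rewrite /diag_act !gact1. Qed.

Fact diag_actM z g h : diag_act z (g * h)%g = diag_act (diag_act z g) h.
Proof. by rewrite /diag_act !gactM. Qed.

Definition free_pairs : gmodule gT := free_gmodule diag_act1 diag_actM.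

Inductive tensor_rel : free_pairs -> Prop :=
| tensor_relDl x y z :
    tensor_rel (<< (x + y, z) >> - (<< (x, z) >> + << (y, z) >>))
| tensor_relDr x y z :
    tensor_rel (<< (x, y + z) >> - (<< (x, y) >> + << (x, z) >>)).

Fact tensor_rel_stable s g : tensor_rel s -> tensor_rel (gact s g).
Proof.
have E (a b c : M * M) :
    @gact _ (free_pairs) (<< a >> - (<< b >> + << c >>)) g
    = << diag_act a g >> - (<< diag_act b g >> + << diag_act c g >>).
  rewrite gactB gactD; congr (_ - (_ + _)); exact: free_pushU.
case=> x y z; rewrite E /diag_act /= ?gactD;
  constructor.
Qed.

Definition tensor2 : gmodule gT := quot_gmodule tensor_rel_stable.

Definition tens (x y : M) : tensor2 := gen_proj tensor_rel << (x, y) >>.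

Lemma tensDl x y z : tens (x + y) z = tens x z + tens y z.
Proof.
rewrite /tens -raddfD; apply/gen_proj_eq/mem_gen_subgroup.
exact: tensor_relDl.
Qed.

Lemma tensDr x y z : tens x (y + z) = tens x y + tens x z.
Proof.
rewrite /tens -raddfD; apply/gen_proj_eq/mem_gen_subgroup.
exact: tensor_relDr.
Qed.

Lemma gact_tens x y g : gact (tens x y) g = tens (gact x g) (gact y g).
Proof.
rewrite [LHS]quot_act_proj; last exact: tensor_rel_stable.
by congr gen_proj; exact: free_pushU.
Qed.

Lemma tensor2_lift (W : zmodType) (f : M -> M -> W) :
    (forall x y z, f (x + y) z = f x z + f y z) ->
    (forall x y z, f x (y + z) = f x y + f x z) ->
  exists h : {additive tensor2 -> W}, forall x y, h (tens x y) = f x y.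
Proof.
move=> fDl fDr.
pose h := freeg_lift (fun z : M * M => f z.1 z.2).
have hU x y : h << (x, y) >> = f x y by rewrite freeg_liftU.
have hS s : tensor_rel s -> h s = 0.
  by case=> x y z; rewrite raddfB raddfD !hU ?fDl ?fDr subrr.
by have [h' h'E] := gen_quot_lift hS; exists h' => x y; rewrite h'E hU.
Qed.

Lemma tensor2_span (H : {pred tensor2}) :
  zmod_closed H -> (forall x y, tens x y \in H) -> forall t, t \in H.
Proof.
move=> HH Ht t; have [x <-] := gen_proj_surj t.
rewrite -[x]freeg_sumE raddf_sum.
under eq_bigr do rewrite -[coeff _ _]intz -freegU_mulz raddfMz.
by apply: zmod_closed_comb => // -[y z]; exact: Ht.
Qed.

Inductive sym_rel : tensor2 -> Prop :=
| SymRel x y : sym_rel (tens x y - tens y x).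

Inductive alt_rel : tensor2 -> Prop :=
| AltRel x : alt_rel (tens x x).

Fact sym_rel_stable s g : sym_rel s -> sym_rel (gact s g).
Proof.
case=> x y; rewrite gactB !gact_tens.
exact: SymRel.
Qed.

Fact alt_rel_stable s g : alt_rel s -> alt_rel (gact s g).
Proof. by case=> x; rewrite gact_tens; exact: AltRel. Qed.

Definition sym2 : gmodule gT := quot_gmodule sym_rel_stable.
Definition alt2 : gmodule gT := quot_gmodule alt_rel_stable.

End TensorSquare.

Section Freeness.
Variables (gT : finGroupType) (M : glattice gT).

Fact sum_biadditive (W : zmodType) (t : M -> M -> W) (I : finType)
    (b : I -> M) (c d : {ffun I -> int}) :
    (forall x y z, t (x + y) z = t x z + t y z) ->
    (forall x y z, t x (y + z) = t x y + t x z) ->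
  t (zcomb b c) (zcomb b d) = \sum_i \sum_j t (b i) (b j) *~ (c i * d j).
Proof.
move=> tDl tDr; pose l y x := t x y.
have t0r x : t x 0 = 0 by apply: (addIr (t x 0)); rewrite -tDr !add0r.
have t0l y : t 0 y = 0 by apply: (addIr (t 0 y)); rewrite -tDl !add0r.
have tBr x : zmod_morphism (t x).
  by move=> y z; apply/eqP; rewrite eq_sym subr_eq -tDr subrK.
have tBl y : zmod_morphism (l y).
  by move=> x z; apply/eqP; rewrite eq_sym subr_eq /l -tDl subrK.
pose T x : {additive M -> W} :=
  HB.pack_for {additive M -> W} (t x) (GRing.isZmodMorphism.Build _ _ (t x) (tBr x)).
pose L y : {additive M -> W} :=
  HB.pack_for {additive M -> W} (l y) (GRing.isZmodMorphism.Build _ _ (l y) (tBl y)).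
rewrite -[LHS]/(L (zcomb b d) (zcomb b c)) raddf_sum; apply: eq_bigr => i _.
rewrite raddfMz -[L _ _]/(T (b i) (zcomb b d)) raddf_sum mulrz_suml.
by apply: eq_bigr => j _; rewrite raddfMz -mulrzA mulrC.
Qed.

Fact tensor2_zfree : zfree (tensor2 M).
Proof.
have [I [b /zbasis_coord [c [cK cb]]]] := lat_free M.
pose B (p : I * I) : tensor2 M := tens (b p.1) (b p.2).
exists (I * I)%type, B.
have [h hE] := @tensor2_lift _ M _
  (fun x y => [ffun p : I * I => c x p.1 * c y p.2])
  ltac:(by move=> x y z; apply/ffunP => p; rewrite !ffunE raddfD ffunE mulrDl)
  ltac:(by move=> x y z; apply/ffunP => p; rewrite !ffunE raddfD ffunE mulrDr).
apply: (@zbasis_of_coord _ _ _ h) => [p|x].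
  rewrite hE; apply/ffunP => q; rewrite !ffunE !cb !ffunE.
  by rewrite -PoszM mulnb.
apply/asboolP; move: x; apply: (tensor2_span (zcomb_closed B)) => x y.
rewrite inE; apply/asboolP; exists [ffun p => c x p.1 * c y p.2].
rewrite -[x in tens x _]cK -[y in tens _ y]cK.
rewrite (sum_biadditive _ _ _ (@tensDl _ M) (@tensDr _ M)) pair_bigA.
by apply: eq_bigr => p _; rewrite ffunE.
Qed.

Definition tensor2_lattice : glattice gT := GLattice tensor2_zfree.

Fact tensor2_quot_span (S : tensor2 M -> Prop) (I : finType) (b : I -> M)
    (H : {pred gen_quot S}) :
    (forall x, exists d, x = zcomb b d) -> zmod_closed H ->
    (forall i j, gen_proj S (tens (b i) (b j)) \in H) -> forall q, q \in H.
Proof.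
move=> bM HH Hb q; have [t <-] := gen_proj_surj q; have [H0 HB] := HH.
suff: t \in [pred u | gen_proj S u \in H] by [].
apply: (tensor2_span (M := M) (H := [pred u | gen_proj S u \in H])) => [|x y].
  split=> [|u v]; rewrite !inE ?raddf0 // raddfB; exact: HB.
have [c ->] := bM x; have [d ->] := bM y.
rewrite (sum_biadditive _ _ _ (@tensDl _ M) (@tensDr _ M)) pair_bigA inE.
rewrite raddf_sum; under eq_bigr do rewrite raddfMz.
by apply: zmod_closed_comb => // -[i j]; exact: Hb.
Qed.

Fact sym2_zfree : zfree (sym2 M).
Proof.
have [I [b /zbasis_coord [c [cK cb]]]] := lat_free M.
pose lei (p : I * I) := (enum_rank p.1 <= enum_rank p.2)%N.
pose J := {p : I * I | lei p}.
pose B (p : J) : sym2 M :=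
  gen_proj (@sym_rel _ M) (tens (b (val p).1) (b (val p).2)).
pose f (x y : M) : {ffun J -> int} := [ffun p : J =>
  let: (i, j) := val p in c x i * c y j + (if i == j then 0 else c x j * c y i)].
have fDl x y z : f (x + y) z = f x z + f y z.
  apply/ffunP => -[[i j] ij]; rewrite !ffunE /= !raddfD !ffunE.
  by case: ifP => _; ring.
have fDr x y z : f x (y + z) = f x y + f x z.
  apply/ffunP => -[[i j] ij]; rewrite !ffunE /= !raddfD !ffunE.
  by case: ifP => _; ring.
have [h hE] := tensor2_lift fDl fDr.
have [|h' h'E] := @gen_quot_lift _ (@sym_rel _ M) _ h.
  move=> _ [x y]; rewrite raddfB !hE; apply/ffunP => -[[i j] ij].
  by rewrite !ffunE /=; case: eqP => [->|_]; ring.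
exists J, B; apply: (@zbasis_of_coord _ _ _ h') => [[[k l] kl]|q].
  rewrite h'E hE /=; apply/ffunP => -[[i j] ij]; rewrite !ffunE /= !cb !ffunE.
  rewrite -val_eqE /= xpair_eqE -!PoszM !mulnb.
  case: (eqVneq i j) => [|nij]; first by rewrite addr0.
  rewrite -[RHS]addr0; congr (_ + _); case: eqP => // kj; case: eqP => // li.
  case/eqP: nij; apply/enum_rank_inj/val_inj/eqP; rewrite eqn_leq.
  by rewrite /lei /= kj li in kl ij *; rewrite ij kl.
apply/asboolP; move: q; apply: (tensor2_quot_span (b := b)) => [x||i j].
- by exists (c x); rewrite cK.
- exact: (zcomb_closed B).
wlog ij : i j / lei (i, j).
  move=> W; case: (leqP (enum_rank i) (enum_rank j)) => [/W //|/ltnW /W Wji].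
  suff -> : gen_proj (@sym_rel _ M) (tens (b i) (b j)) =
    gen_proj (@sym_rel _ M) (tens (b j) (b i)) by [].
  by apply/gen_proj_eq/mem_gen_subgroup; exact: SymRel.
apply/asboolP; exists (zdelta (exist _ (i, j) ij : J)).
by rewrite zcomb_delta.
Qed.

Definition sym2_lattice : glattice gT := GLattice sym2_zfree.

Fact alt2_zfree : zfree (alt2 M).
Proof.
have [I [b /zbasis_coord [c [cK cb]]]] := lat_free M.
pose lti (p : I * I) := (enum_rank p.1 < enum_rank p.2)%N.
pose J := {p : I * I | lti p}.
pose pi : {additive tensor2 M -> gen_quot (@alt_rel _ M)} := gen_proj (@alt_rel _ M).
pose B (p : J) : alt2 M := pi (tens (b (val p).1) (b (val p).2)).
pose f (x y : M) : {ffun J -> int} := [ffun p : J =>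
  let: (i, j) := val p in c x i * c y j - c x j * c y i].
have fDl x y z : f (x + y) z = f x z + f y z.
  by apply/ffunP => -[[i j] ij]; rewrite !ffunE /= !raddfD !ffunE; ring.
have fDr x y z : f x (y + z) = f x y + f x z.
  by apply/ffunP => -[[i j] ij]; rewrite !ffunE /= !raddfD !ffunE; ring.
have [h hE] := tensor2_lift fDl fDr.
have [|h' h'E] := @gen_quot_lift _ (@alt_rel _ M) _ h.
  move=> _ [x]; rewrite hE; apply/ffunP => -[[i j] ij].
  by rewrite !ffunE /=; ring.
have pi0 x : pi (tens x x) = 0.
  rewrite -[RHS](raddf0 pi); apply/gen_proj_eq/mem_gen_subgroup.
  by rewrite subr0; exact: AltRel.
have piN x y : pi (tens x y) = - pi (tens y x).
  have := pi0 (x + y); rewrite tensDl !tensDr !raddfD /= !pi0 add0r addr0.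
  by move/eqP; rewrite addr_eq0 => /eqP.
exists J, B; apply: (@zbasis_of_coord _ _ _ h') => [[[k l] kl]|q].
  rewrite h'E hE /=; apply/ffunP => -[[i j] ij]; rewrite !ffunE /= !cb !ffunE.
  rewrite -val_eqE /= xpair_eqE -!PoszM !mulnb.
  rewrite -[RHS]subr0; congr (_ - _); case: eqP => // kj; case: eqP => // li.
  by move: kl ij; rewrite /lti /= kj li => ji /(ltn_trans ji); rewrite ltnn.
apply/asboolP; move: q; apply: (tensor2_quot_span (b := b)) => [x||i j].
- by exists (c x); rewrite cK.
- exact: (zcomb_closed B).
have [H0 HB] := zcomb_closed B.
have lt_in k l : lti (k, l) -> pi (tens (b k) (b l)) \in
    [pred q | `[< exists d, q = zcomb B d >]].
  move=> kl; rewrite inE; apply/asboolP.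
  by exists (zdelta (exist _ (k, l) kl : J)); rewrite zcomb_delta.
case: (ltngtP (enum_rank i) (enum_rank j)) => [/lt_in //|ji|/val_inj].
  by rewrite -/pi piN -sub0r; apply: HB => //; exact: lt_in.
by move/enum_rank_inj => ->; rewrite -/pi pi0.
Qed.

Definition alt2_lattice : glattice gT := GLattice alt2_zfree.

End Freeness.

Section RootLattice.
Variable n : nat.

Definition sum_zero : {pred {ffun 'I_n -> int}} :=
  [pred z : {ffun 'I_n -> int} | \sum_i z i == 0 :> int].

Fact sum_zero_closed : zmod_closed sum_zero.
Proof.
split=> [|y z]; rewrite !inE.
  by apply/eqP; rewrite big1 // => i _; rewrite ffunE.
move=> /eqP y0 /eqP z0; apply/eqP.
transitivity (\sum_i y i - \sum_i z i); last by rewrite y0 z0 subrr.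
by rewrite -sumrB; apply: eq_bigr => i _; rewrite !ffunE.
Qed.
HB.instance Definition _ := GRing.isZmodClosed.Build _ sum_zero sum_zero_closed.

Record root_vec := RootVec {
  root_val :> {ffun 'I_n -> int};
  root_valP : root_val \in sum_zero
}.
HB.instance Definition _ := [isSub for root_val].
HB.instance Definition _ := [Choice of root_vec by <:].
HB.instance Definition _ := [SubChoice_isSubZmodule of root_vec by <:].

(* The permutation s moves the i-th coordinate to position s i. *)
Definition perm_coord (z : {ffun 'I_n -> int}) (s : 'S_n) : {ffun 'I_n -> int} :=
  [ffun i => z ((s^-1)%g i)].

Fact perm_coord_root (z : root_vec) s : perm_coord z s \in sum_zero.
Proof.
rewrite inE (reindex_inj (@perm_inj _ s)) /= -[X in _ == X](eqP (root_valP z)).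
by apply/eqP; apply: eq_bigr => i _; rewrite ffunE permK.
Qed.

Definition root_act (z : root_vec) (s : 'S_n) : root_vec :=
  RootVec (perm_coord_root z s).

Fact root_act1 z : root_act z 1%g = z.
Proof. by apply/val_inj/ffunP => i; rewrite ffunE invg1 perm1. Qed.

Fact root_actM z s t : root_act z (s * t)%g = root_act (root_act z s) t.
Proof. by apply/val_inj/ffunP => i; rewrite !ffunE invMg permM. Qed.

Fact root_actD y z s : root_act (y + z) s = root_act y s + root_act z s.
Proof. by apply/val_inj/ffunP => i; rewrite !ffunE. Qed.

Definition root_gmodule : gmodule 'S_n := GModule root_act1 root_actM root_actD.

End RootLattice.

Fact root_zfree n : zfree (root_gmodule n).
Proof.
case: n => [|n].
  exists void, (fun v : void => match v with end) => x; exists 0.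
  by split=> [|c _]; [apply/val_inj/ffunP | apply/ffunP] => -[].
pose e (i : 'I_n) : {ffun 'I_n.+1 -> int} :=
  zdelta (fintype.lift ord0 i) - zdelta ord0.
have eP i : e i \in @sum_zero n.+1.
  rewrite inE big_ord_recl (bigD1 i) //= !ffunE eqxx.
  rewrite big1 ?addr0 => [|j ji]; first by rewrite !eqxx.
  by rewrite !ffunE (inj_eq lift_inj) eq_sym (negbTE ji).
pose b i : root_gmodule n.+1 := RootVec (eP i).
pose c (z : root_gmodule n.+1) : {ffun 'I_n -> int} :=
  [ffun i => root_val z (fintype.lift ord0 i)].
have cB : zmod_morphism c by move=> y z; apply/ffunP => i; rewrite !ffunE.
exists 'I_n, b.
pose cA : {additive root_gmodule n.+1 -> {ffun 'I_n -> int}} :=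
  HB.pack_for {additive root_gmodule n.+1 -> {ffun 'I_n -> int}} c
    (GRing.isZmodMorphism.Build _ _ c cB).
have cb i : cA (b i) = zdelta i.
  by apply/ffunP => j; rewrite !ffunE (inj_eq lift_inj) subr0.
apply: (zbasis_of_coord cb) => z.
exists (c z); pose w : root_gmodule n.+1 := zcomb b (c z).
have E (i : 'I_n) :
    root_val z (fintype.lift ord0 i) = root_val w (fintype.lift ord0 i).
  by have /ffunP/(_ i) := coord_zcomb cb (c z); rewrite !ffunE.
apply/val_inj/ffunP => j; have [i ->|->] := unliftP ord0 j; first exact: E.
have := root_valP z; have := root_valP w.
rewrite !inE !big_ord_recl -(eq_bigr _ (fun i _ => E i)).
by move=> /eqP <-; rewrite (inj_eq (addIr _)) => /eqP.
Qed.

(* The root lattice A_(n-1) with the action of the symmetric group on n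
   letters. *)
Definition root_lattice (n : nat) : glattice 'S_n := GLattice (root_zfree n).

(* Main.v *)
Require Import Defs.
From HB Require Import structures.
From mathcomp Require Import all_boot all_order all_algebra all_fingroup.
From mathcomp Require Import boolp ring zify.

(** The lattices are separated by Sha^2(H, M), the group of classes in
    H^2(H, M) that vanish on every cyclic subgroup of H, for a suitable Klein
    four-subgroup H of the symmetric group.

    For a permutation lattice P and any finite group K one has H^1(K, P) = 0
    ([permutation_lattice_cocycle1]) and Sha^2(K, P) = 0
    ([permutation_lattice_sha2]).  Hence in an exact sequence
    0 -> M -> E -> P -> 0 the groups Sha^2 of M and of E vanish together
    ([sha2_sub], [sha2_ext]), the vanishing of Sha^2 depends only on the
    equivalence class of a lattice, holds for quasi-permutation lattices and
    passes to direct summands.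

    Let A be the root lattice and a the 1-cocycle s |-> e_(s 0) - e_0 with values
    in A.  Its cup square is a 2-cocycle with values in the tensor square of A.
    If each element of H fixes a letter, a is a coboundary on each cyclic
    subgroup, and the cup square is locally split.  If every H-invariant vector
    of Z^n has even coordinate sum, which holds when all orbits are even, then
    not even the image of the cup square in the symmetric square splits
    ([cup_square_not_sym_split]).  So Sha^2 is nonzero for both the tensor and the
    symmetric square.

    For the exterior square, 0 -> Alt^2 A -> Alt^2 Z^n -> A -> 0 is exact, and
    Alt^2 Z^n, as the kernel of the map from the tensor to the symmetric square
    of the permutation lattice Z^n, has trivial Sha^2.  If H has an orbit with two
    letters 0 and 1, the class of a, which generates H^1(H, A), comes from
    H^1(H, Alt^2 Z^n): it is the image of the cocycle s |-> e_(s 0) ^ e_0.  So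
    nothing new arises from H^1(H, A), and Sha^2 of the exterior square is zero
    ([alt2_sha2_trivial]).

    For even n >= 6 the pairing of the letters gives a Klein four-group whose
    orbits all have two elements and whose three nontrivial characters all occur
    ([klein_four]), so that all these conditions hold together. *)

(* The name gact would otherwise refer to group actions. *)
Import Defs.
Set Implicit Arguments.
Unset Strict Implicit.
Unset Printing Implicit Defensive.
Import Order.TTheory GRing.Theory Num.Theory.
Local Open Scope ring_scope.

(** * Low-degree cochains and the locally trivial part of H^2 *)

Section Cochains.
Variables (gT : finGroupType) (M : gmodule gT).
Implicit Types (K : {group gT}) (h k : gT) (p : M).

Lemma gact0 k : gact (0 : M) k = 0.
Proof. exact: (raddf0 (gact_by k)). Qed.

Lemma gact_sum (I : Type) (r : seq I) (Q : pred I) (F : I -> M) k :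
  gact (\sum_(i <- r | Q i) F i) k = \sum_(i <- r | Q i) gact (F i) k.
Proof. exact: (raddf_sum (gact_by k)). Qed.

Lemma gactMn p (m : nat) k : gact (p *+ m) k = gact p k *+ m.
Proof. exact: (raddfMn (gact_by k)). Qed.

Lemma gactMz p (m : int) k : gact (p *~ m) k = gact p k *~ m.
Proof. exact: (raddfMz (gact_by k)). Qed.

(** The differentials of the bar resolution for a right module; the value of
    [diff1 g] at (h, k) measures the failure of g to be a crossed
    homomorphism. *)
Definition diff0 p k : M := gact p k - p.

Definition diff1 (z : gT -> M) h k : M := gact (z h) k + z k - z (h * k)%g.

Definition cocycle1 (K : {set gT}) (z : gT -> M) :=
  {in K &, forall h k, diff1 z h k = 0}.

Definition cocycle2 (K : {set gT}) (phi : gT -> gT -> M) :=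
  {in K & &, forall h k l,
    gact (phi h k) l + phi (h * k)%g l = phi h (k * l)%g + phi k l}.

Definition splits_on (K : {set gT}) (phi : gT -> gT -> M) :=
  exists g, {in K &, forall h k, phi h k = diff1 g h k}.

(** Vanishing of the kernel of H^2(H, M) -> prod_C H^2(C, M), where C runs over
    the cyclic subgroups of H. *)
Definition sha2_trivial (H : {group gT}) :=
  forall phi, cocycle2 H phi ->
    {in H, forall c, splits_on <[c]>%g phi} -> splits_on H phi.

Lemma diff1B (y z : gT -> M) h k :
  diff1 (fun k => y k - z k) h k = diff1 y h k - diff1 z h k.
Proof.
rewrite /diff1 gactB !opprD !opprK !addrA.
by rewrite [LHS](ACl (1*3*5*2*4*6)).
Qed.

Lemma diff1D (y z : gT -> M) h k :
  diff1 (fun k => y k + z k) h k = diff1 y h k + diff1 z h k.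
Proof.
by rewrite /diff1 gactD !opprD !addrA [LHS](ACl (1*3*5*2*4*6)).
Qed.

Lemma eq_diff1 K (y z : gT -> M) : {in K, y =1 z} ->
  {in K &, forall h k, diff1 y h k = diff1 z h k}.
Proof. by move=> yz h k hK kK; rewrite /diff1 !yz ?groupM. Qed.

Lemma diff1_diff0 p h k : diff1 (diff0 p) h k = 0.
Proof.
by rewrite /diff1 /diff0 gactB gactM addrA subrK subrr.
Qed.

Lemma diff1_cocycle2 (K : {group gT}) (g : gT -> M) : cocycle2 K (diff1 g).
Proof.
move=> h k l _ _ _; rewrite /diff1 mulgA !gactB !gactD -!gactM.
have E (a b c d e f : M) : a + b - c + (c + d - e) = a + f - e + (b + d - f).
  by rewrite !addrA subrK [RHS](ACl (1*4*5*3*2*6)) /= addrK.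
exact: E.
Qed.

Lemma cocycle1E K z h k :
  cocycle1 K z -> h \in K -> k \in K -> z (h * k)%g = gact (z h) k + z k.
Proof. by move=> zK hK kK; apply/esym/eqP; rewrite -subr_eq0 [_ - _]zK. Qed.

(** Averaging: the order of the group kills H^1.  The sums of z (h * k) and of
    z h over the group agree, and the cocycle identity compares them. *)
Lemma cocycle1_average K z k : cocycle1 K z -> k \in K ->
  z k *+ #|K| = \sum_(h in K) z h - gact (\sum_(h in K) z h) k.
Proof.
move=> zK kK; apply/esym/eqP; rewrite subr_eq addrC; apply/eqP.
rewrite [LHS](reindex_inj (mulIg k)) /=.
rewrite (eq_bigl (mem K)) => [|h]; last exact: groupMr.
rewrite gact_sum -sumr_const -big_split /=; apply: eq_bigr => h hK.
by rewrite (cocycle1E zK).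
Qed.

(** The same averaging, in the first argument, one degree higher. *)
Lemma cocycle2_average K phi k l : cocycle2 K phi -> k \in K -> l \in K ->
  phi k l *+ #|K| = diff1 (fun k => \sum_(h in K) phi h k) k l.
Proof.
move=> phiK kK lK; rewrite /diff1; apply/esym/eqP; rewrite subr_eq; apply/eqP.
rewrite [X in _ + X](reindex_inj (mulIg k)) /=.
rewrite [X in _ + X](eq_bigl (mem K)) => [|h]; last exact: groupMr.
rewrite gact_sum -sumr_const -!big_split /=; apply: eq_bigr => h hK.
by rewrite phiK // addrC.
Qed.

End Cochains.

Section Functoriality.
Variables (gT : finGroupType) (M N : gmodule gT) (f : {additive M -> N}).
Hypothesis fE : equivariant f.

Lemma diff0_map p k : diff0 (f p) k = f (diff0 p k).
Proof. by rewrite /diff0 raddfB fE. Qed.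

Lemma diff1_map z h k : diff1 (fun k => f (z k)) h k = f (diff1 z h k).
Proof. by rewrite /diff1 raddfB raddfD fE. Qed.

Lemma cocycle2_map (K : {set gT}) phi :
  cocycle2 K phi -> cocycle2 K (fun h k => f (phi h k)).
Proof.
by move=> phiK h k l hK kK lK; rewrite -fE -!raddfD phiK.
Qed.

Lemma splits_on_map (K : {set gT}) phi :
  splits_on K phi -> splits_on K (fun h k => f (phi h k)).
Proof.
move=> [g gE]; exists (fun k => f (g k)) => h k hK kK.
by rewrite diff1_map gE.
Qed.

End Functoriality.

(** * Permutation modules *)

Section Coordinates.
Variables (gT : finGroupType) (X : finType) (to : {action gT &-> X}).

(** Shapiro's lemma in degree one, with coefficients in Z/N (in Z for N = 0):
    in each orbit a base point r is chosen, and the potential at x = r t is read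
    off from the value of z at the transporter t.  Two transporters differ by an
    element of the stabilizer of r, where z vanishes by hypothesis, so the choice
    of t does not matter modulo N. *)
Lemma coboundary_mod (K : {group gT}) (N : int) (z : gT -> X -> int) :
    {in K &, forall h k x,
      (N %| z (h * k)%g x - (z h (to x k^-1%g) + z k x))%Z} ->
    (forall h x, h \in K -> to x h = x -> (N %| z h x)%Z) ->
  exists p : {ffun X -> int}, {in K, forall k x,
    (N %| z k x - (p (to x k^-1%g) - p x))%Z}.
Proof.
move=> zM zS.
pose r x := odflt x [pick y in orbit to K x].
have rP x : r x \in orbit to K x.
  by rewrite /r; case: pickP => //= _; exact: orbit_refl.
have rE x k : k \in K -> r (to x k^-1%g) = r x.
  move=> kK; rewrite /r; have /orbit_eqP E : to x k^-1%g \in orbit to K x.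
    by rewrite mem_orbit // groupV.
  rewrite E; case: pickP => //= /(_ x); rewrite orbit_refl //.
have tP x : exists t, (t \in K) && (to (r x) t == x).
  have := rP x; rewrite orbit_sym => /orbitP [t tK tx].
  by exists t; rewrite tK tx eqxx.
pose t x := xchoose (tP x).
have [tK tE] : (forall x, t x \in K) /\ (forall x, to (r x) (t x) = x).
  by split=> x; have /andP [? /eqP] := xchooseP (tP x).
exists [ffun x => - z (t x) x] => k kK x; rewrite !ffunE opprK.
set y := to x k^-1%g; pose m := (t y * k)%g.
have mK : m \in K by rewrite groupM.
have mE : to (r x) m = x by rewrite actM -(rE x k) // tE actKV.
pose s := (t x * m^-1)%g.
have sK : s \in K by rewrite groupM ?groupV.
have sE : to (r x) s = r x.
  by rewrite actM tE -[X in to X _]mE actK.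
have mE' : to x m^-1%g = r x by rewrite -{1}mE actK.
have := zM _ _ sK mK x; rewrite [(s * m)%g]mulgKV mE' => D1.
have := zM _ _ (tK y) kK x; rewrite -/y -/m => D2.
have D3 := zS _ _ sK sE.
have -> : z k x - (- z (t y) y + z (t x) x) =
   - (z (t x) x - (z s (r x) + z m x)) - z s (r x) - (z m x - (z (t y) y + z k x)).
  by ring.
by apply: rpredB D2; apply: rpredB D3; rewrite rpredN.
Qed.

(** A permutation module is given by its coordinate functions rather than by a
    basis, so that function spaces are an instance with the identity map. *)
Definition perm_coords (P : gmodule gT) (c : {additive P -> {ffun X -> int}}) :=
  bijective c /\ forall p g x, c (gact p g) x = c p (to x g^-1%g).

Variables (P : gmodule gT) (c : {additive P -> {ffun X -> int}}).
Hypothesis cP : perm_coords c.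

(** Such a coordinate is a homomorphism from a finite stabilizer to Z. *)
Lemma cocycle1_fixed_coord (K : {group gT}) z h x :
  cocycle1 K z -> h \in K -> to x h = x -> c (z h) x = 0.
Proof.
have [_ cE] := cP; move=> zK hK hx.
have := congr1 (fun p => c p x) (cocycle1_average zK hK).
rewrite raddfMn raddfB !ffunE cE ffunMnE.
have -> : to x h^-1%g = x by rewrite -{1}hx actK.
rewrite subrr => /eqP; rewrite mulrn_eq0 => /orP [|/eqP //].
by rewrite eqn0Ngt cardG_gt0.
Qed.

Lemma perm_coords_cocycle1 (K : {group gT}) z :
  cocycle1 K z -> exists p : P, {in K, forall k, z k = diff0 p k}.
Proof.
have [[d cK dK] cE] := cP.
move=> zK; have [||q qE] := @coboundary_mod K 0 (fun k => c (z k)).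
- move=> h k hK kK x.
  by rewrite (cocycle1E zK) // raddfD ffunE cE subrr.
- by move=> h x hK hx; rewrite dvd0z (cocycle1_fixed_coord zK).
exists (d q) => k kK; apply: (can_inj cK); apply/ffunP => x.
have := qE k kK x; rewrite dvd0z subr_eq0 => /eqP ->.
by rewrite raddfB !ffunE cE dK.
Qed.

(** By averaging, #|H| phi is the coboundary of an integral cochain G, which is
    thus a 1-cocycle modulo #|H|.  On a stabilizer this cocycle is a homomorphism
    to Z/#|H|, and a homomorphism is determined on cyclic subgroups, where phi
    splits; so it vanishes, and G is a coboundary modulo #|H|.  Subtracting it
    and dividing by #|H| splits phi. *)
Lemma perm_coords_sha2 (H : {group gT}) : sha2_trivial P H.
Proof.
have [[d cK dK] cE] := cP; have cI := can_inj cK.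
move=> phi phiH phiC; pose N : int := #|H|%:Z.
have N0 : N != 0 by rewrite eqz_nat -lt0n cardG_gt0.
pose G k := \sum_(h in H) phi h k.
have GE := cocycle2_average phiH; rewrite -/G in GE.
have [||q qE] := @coboundary_mod H N (fun k => c (G k)).
- move=> h k hH kH x; apply/dvdzP; exists (- c (phi h k) x).
  have := congr1 (fun p => c p x) (GE h k hH kH).
  rewrite /diff1 raddfB raddfD raddfMn !ffunE cE ffunMnE => E.
  by rewrite -opprB -E mulNr -mulr_natr natz.
- move=> h x hH hx; have [g gE] := phiC h hH.
  have sub k : k \in <[h]>%g -> k \in H.
    by apply/subsetP; rewrite cycle_subG.
  (* On the cyclic subgroup, phi = diff1 g, so G - #|H| g is a true cocycle,
     and its coordinate at the fixed point x is zero. *)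
  have zC : cocycle1 <[h]>%g (fun k => G k - g k *+ #|H|).
    move=> k l kC lC; rewrite diff1B -GE ?sub // gE //.
    rewrite /diff1 -[X in _ - X]/(diff1 (fun k => g k *+ #|H|) k l) /diff1.
    by rewrite gactMn -mulrnDl -mulrnBl subrr.
  have := cocycle1_fixed_coord zC (cycle_id h) hx.
  rewrite raddfB raddfMn !ffunE ffunMnE => /eqP; rewrite subr_eq0 => /eqP ->.
  by rewrite -mulr_natr natz dvdz_mull.
pose g k := d [ffun x => ((c (G k) x - (q (to x k^-1%g) - q x)) %/ N)%Z].
have gE k : k \in H -> g k *+ #|H| = G k - diff0 (d q) k.
  move=> kH; apply: cI; apply/ffunP => x.
  rewrite raddfMn ffunMnE dK !ffunE -mulr_natr natz divzK ?qE //.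
  by rewrite !raddfB !ffunE cE dK.
have tf (y z : P) : y *+ #|H| = z *+ #|H| -> y = z.
  move=> yz; apply: cI; apply/ffunP => x; apply/eqP.
  have := congr1 (fun p => c p x) yz; rewrite !raddfMn !ffunMnE => /eqP.
  by rewrite eqrMn2r eqn0Ngt cardG_gt0.
exists g => h k hH kH; apply: tf; rewrite GE //.
rewrite -[LHS]subr0 -(diff1_diff0 (d q) h k) -diff1B.
rewrite /diff1 -!gE ?groupM // mulrnBl mulrnDl.
by rewrite gactMn.
Qed.

End Coordinates.

(** * Invariance under equivalence of lattices *)

Section PermutationLattices.
Variables (gT : finGroupType) (P : glattice gT).
Hypothesis permP : permutation_lattice P.

Lemma permutation_lattice_coords :
  exists (X : finType) (to : {action gT &-> X})
    (c : {additive P -> {ffun X -> int}}), perm_coords to c.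
Proof.
have [X [b [bP bact]]] := permP.
have [c [cK cb]] := zbasis_coord bP; have zK := coord_zcomb cb.
have bI : injective b.
  move=> i j bij; have := cb j; rewrite -bij cb => /ffunP /(_ j).
  by rewrite !ffunE eqxx; case: eqP.
pose to i g := projT1 (cid (bact i g)).
have toE i g : b (to i g) = gact (b i) g by rewrite /to; case: cid.
have to1 : to^~ 1%g =1 id by move=> i; apply: bI; rewrite toE gact1.
have toM i : act_morph to i by move=> g h; apply: bI; rewrite !toE gactM.
exists X, (TotalAction to1 toM), c; split=> [|p g x]; first by exists (zcomb b).
rewrite -{1}(cK p) gact_sum /=.
rewrite (eq_bigr (fun i => b (to i g) *~ c p i)) => [|i _]; last first.
  by rewrite gactMz toE.
rewrite (reindex_inj (act_inj (TotalAction to1 toM) g^-1%g)) /=.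
rewrite (_ : \sum_i _ = zcomb b [ffun i => c p (to i g^-1%g)]).
  by rewrite zK ffunE.
by apply: eq_bigr => i _; rewrite ffunE -toM mulVg to1.
Qed.

Lemma permutation_lattice_cocycle1 (K : {group gT}) (z : gT -> P) :
  cocycle1 K z -> exists p : P, {in K, forall k, z k = diff0 p k}.
Proof.
by have [X [to [c cP]]] := permutation_lattice_coords; exact: (perm_coords_cocycle1 cP).
Qed.

Lemma permutation_lattice_sha2 (H : {group gT}) : sha2_trivial P H.
Proof.
by have [X [to [c cP]]] := permutation_lattice_coords; exact: (perm_coords_sha2 cP).
Qed.

End PermutationLattices.

Lemma choice_in (T U : Type) (A : {pred T}) (u0 : U) (R : T -> U -> Prop) :
  {in A, forall t, exists u, R t u} -> exists g, {in A, forall t, R t (g t)}.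
Proof.
move=> ex; have ex' t : exists u, t \in A -> R t u.
  have [/ex [u Ru]|nA] := boolP (t \in A); first by exists u.
  by exists u0.
by exists (fun t => projT1 (cid (ex' t))) => t tA; case: cid => u /= /(_ tA).
Qed.

Section ExactSequences.
Variables (gT : finGroupType) (H : {group gT}).

(** A splitting g of phi in E becomes a 1-cocycle in P, hence a coboundary as
    H^1(H, P) = 0; correcting g by a lift of it brings g back into M. *)
Lemma sha2_sub (M E : gmodule gT) (P : glattice gT) :
  permutation_lattice P -> short_exact M E P ->
  sha2_trivial E H -> sha2_trivial M H.
Proof.
move=> permP [f [p [fE pE fI pS ker]]] shaE phi phiH phiC.
have [c cH|g gE] := shaE _ (cocycle2_map fE phiH).
  exact/(splits_on_map fE)/phiC.
have pf x : p (f x) = 0 by apply/ker; exists x.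
have [q qE] : exists q, {in H, forall k, p (g k) = diff0 q k}.
  apply: permutation_lattice_cocycle1 => // h k hH kH.
  by rewrite (diff1_map pE) -gE.
have [y yE] := pS q.
have [|g' g'E] := @choice_in _ M H 0 (fun k x => f x = g k - diff0 y k).
  by move=> k kH; apply/ker; rewrite raddfB qE // /diff0 raddfB pE yE subrr.
exists g' => h k hH kH; apply: fI.
by rewrite gE // -(diff1_map fE) (eq_diff1 g'E) // diff1B diff1_diff0 subr0.
Qed.

(** The image of phi in P is locally split, hence split; correcting phi by a lift
    of the splitting gives a cocycle psi with values in M.  It is still locally
    split in M, and not only in E, because H^1(C, P) = 0 for C cyclic. *)
Lemma sha2_ext (M E : gmodule gT) (P : glattice gT) :
  permutation_lattice P -> short_exact M E P ->
  sha2_trivial M H -> sha2_trivial E H.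
Proof.
move=> permP [f [p [fE pE fI pS ker]]] shaM phi phiH phiC.
have [c cH|gP gPE] := permutation_lattice_sha2 permP (cocycle2_map pE phiH).
  exact/(splits_on_map pE)/phiC.
pose g k := projT1 (cid (pS (gP k))).
have gE k : p (g k) = gP k by rewrite /g; case: cid.
pose psi h k := phi h k - diff1 g h k.
have [|phi0 phi0E] := @choice_in _ M [predX H & H] 0
    (fun hk x => f x = psi hk.1 hk.2).
  move=> [h k] /andP [hH kH]; apply/ker.
  by rewrite raddfB gPE // -(diff1_map pE) /diff1 !gE subrr.
pose phi' h k := phi0 (h, k).
have phi'E : {in H &, forall h k, f (phi' h k) = psi h k}.
  by move=> h k hH kH; rewrite phi0E //; apply/andP.
have [h k l hH kH lH|c cH|g' g'E] := shaM phi'.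
- apply: fI; rewrite !raddfD fE !phi'E ?groupM // /psi.
  have := diff1_cocycle2 g hH kH lH => E1.
  by rewrite gactB addrACA -opprD E1 phiH // opprD addrACA.
- have sub k : k \in <[c]>%g -> k \in H.
    by apply/subsetP; rewrite cycle_subG.
  have [gc gcE] := phiC c cH.
  have [q qE] : exists q,
      {in <[c]>%g, forall k, p (gc k - g k) = diff0 q k}.
    apply: permutation_lattice_cocycle1 => // h k hC kC.
    rewrite (diff1_map pE) diff1B raddfB -gcE // gPE ?sub //.
    by rewrite -(diff1_map pE) /diff1 !gE subrr.
  have [y yE] := pS q.
  have [|x xE] := @choice_in _ M <[c]>%g 0
      (fun k x => f x = gc k - g k - diff0 y k).
    by move=> k kC; apply/ker; rewrite raddfB qE // /diff0 raddfB pE yE subrr.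
  exists x => h k hC kC; apply: fI; rewrite phi'E ?sub // -(diff1_map fE).
  by rewrite (eq_diff1 xE) // diff1B diff1_diff0 subr0 diff1B -gcE.
exists (fun k => f (g' k) + g k) => h k hH kH.
rewrite (diff1D (fun k => f (g' k)) g).
by rewrite (diff1_map fE) -g'E // phi'E // subrK.
Qed.

Lemma sha2_equiv (M N : glattice gT) :
  lat_equiv M N -> sha2_trivial M H <-> sha2_trivial N H.
Proof.
move=> [E [P [Q [permP permQ exP exQ]]]]; split=> sha.
  exact/(sha2_sub permQ exQ)/(sha2_ext permP exP).
exact/(sha2_sub permP exP)/(sha2_ext permQ exQ).
Qed.

Lemma sha2_quasi_permutation (M : glattice gT) :
  quasi_permutation M -> sha2_trivial M H.
Proof.
move=> [P [Q [permP permQ ex]]].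
exact/(sha2_sub permQ ex)/permutation_lattice_sha2.
Qed.

Lemma sha2_summand (N M : glattice gT) :
  direct_summand N M -> sha2_trivial M H -> sha2_trivial N H.
Proof.
move=> [N' [f [[r fK rK] fE]]] shaM phi phiH phiC.
have fE0 x g : gact (f (x, 0)) g = f (gact x g, 0) by rewrite -fE gact0.
pose i (x : N) : M := f (x, 0).
have iB : zmod_morphism i.
  move=> x y; rewrite /i -(raddfB f); apply: congr1.
  by apply: injective_projections => //=; rewrite subr0.
pose iA : {additive N -> M} := HB.pack_for {additive N -> M} i
  (GRing.isZmodMorphism.Build _ _ i iB).
have iE : equivariant iA by move=> x g; rewrite /= /i fE0.
have [c cH|g gE] := shaM _ (cocycle2_map iE phiH).
  exact/(splits_on_map iE)/phiC.
exists (fun k => (r (g k)).1) => h k hH kH.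
have gEr l : g l = f ((r (g l)).1, (r (g l)).2) by rewrite -surjective_pairing rK.
have fgE : f (phi h k, 0) = f ((gact (r (g h)).1 k, gact (r (g h)).2 k)
    + ((r (g k)).1, (r (g k)).2)
    - ((r (g (h * k)%g)).1, (r (g (h * k)%g)).2)).
  by rewrite raddfB raddfD fE -!gEr; exact: gE.
by have := congr1 fst (can_inj fK fgE).
Qed.

End ExactSequences.

(** * Function modules and matrices *)

Lemma sum_zdelta (I : finType) (i : I) : \sum_j zdelta i j = 1 :> int.
Proof.
by rewrite (bigD1 i) //= ffunE eqxx big1 // => j; rewrite ffunE eq_sym => /negbTE ->.
Qed.

Section FunctionModules.
Variables (gT : finGroupType) (X : finType) (to : {action gT &-> X}).
Implicit Type f : {ffun X -> int}.

Definition fun_act f (g : gT) : {ffun X -> int} := [ffun x => f (to x g^-1%g)].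

Fact fun_act1 f : fun_act f 1%g = f.
Proof. by apply/ffunP => x; rewrite ffunE invg1 act1. Qed.

Fact fun_actM f g h : fun_act f (g * h)%g = fun_act (fun_act f g) h.
Proof. by apply/ffunP => x; rewrite !ffunE invMg actM. Qed.

Fact fun_actD f f' g : fun_act (f + f') g = fun_act f g + fun_act f' g.
Proof. by apply/ffunP => x; rewrite !ffunE. Qed.

Definition fun_gmodule : gmodule gT := GModule fun_act1 fun_actM fun_actD.

Lemma fun_gmodule_coords :
  perm_coords to (idfun : {additive fun_gmodule -> {ffun X -> int}}).
Proof. by split=> [|p g x]; [exists idfun | rewrite ffunE]. Qed.

Definition fun_gmodule_cocycle1 := perm_coords_cocycle1 fun_gmodule_coords.
Definition fun_gmodule_sha2 := perm_coords_sha2 fun_gmodule_coords.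

Lemma sum_fun_act f g : \sum_x fun_act f g x = \sum_x f x.
Proof.
rewrite (reindex_inj (act_inj to g)) /=; apply: eq_bigr => x _.
by rewrite ffunE actK.
Qed.

End FunctionModules.

Section Push.
Variables (X Y : finType) (p : X -> Y).

Definition push (f : {ffun X -> int}) : {ffun Y -> int} :=
  [ffun y => \sum_(x | p x == y) f x].

Fact push_additive : zmod_morphism push.
Proof.
move=> f f'; apply/ffunP => y; rewrite !ffunE -sumrB.
by apply: eq_bigr => x _; rewrite !ffunE.
Qed.
HB.instance Definition _ := GRing.isZmodMorphism.Build _ _ push push_additive.

Lemma sum_push f : \sum_y push f y = \sum_x f x.
Proof.
rewrite [RHS](partition_big p predT) //=.
by apply: eq_bigr => y _; rewrite ffunE.
Qed.

Lemma push_section (q : {ffun Y -> int}) : exists f, forall x, push f (p x) = q (p x).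
Proof.
pose s y := [pick x | p x == y].
exists [ffun x => if s (p x) == Some x then q (p x) else 0] => x.
have [x0 sx px0] : exists2 x0, s (p x) = Some x0 & p x0 = p x.
  by rewrite /s; case: pickP => [x0 /eqP ?|/(_ x)]; [exists x0 | rewrite eqxx].
rewrite ffunE (bigD1 x0) ?px0 //= ffunE px0 sx eqxx big1 ?addr0 // => x1.
move=> /andP [/eqP px1 nx]; rewrite ffunE px1 sx.
by case: eqP => // -[xE]; rewrite xE eqxx in nx.
Qed.

Variables (gT : finGroupType) (toX : {action gT &-> X}) (toY : {action gT &-> Y}).
Hypothesis pE : forall x g, p (toX x g) = toY (p x) g.

Definition push_hom : {additive fun_gmodule toX -> fun_gmodule toY} := push.

Lemma push_equivariant : equivariant push_hom.
Proof.
move=> f g; apply/ffunP => y; rewrite !ffunE.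
rewrite (reindex_inj (act_inj toX g)) /=; apply: eq_big => [x|x _].
  by rewrite pE -{1}(actKV toY g y) (inj_eq (act_inj toY g)).
by rewrite ffunE actK.
Qed.

(** The push-forward of z is a 1-cocycle in a permutation module, hence a
    coboundary; its potential lifts along p on the image of p, and both sides
    vanish off that image. *)
Lemma push_cocycle1_lift (K : {group gT}) (z : gT -> fun_gmodule toX) :
  {in K &, forall h k, push_hom (diff1 z h k) = 0} ->
  exists f, {in K, forall k, push_hom (z k - diff0 f k) = 0}.
Proof.
move=> zK; have [h k hK kK|q qE] :=
  @fun_gmodule_cocycle1 _ _ toY K (fun k => push_hom (z k)).
  by rewrite (diff1_map push_equivariant) zK.
have [f fq] := push_section q; exists f => k kK; apply/ffunP => y.
have [/existsP [x /eqP <-]|nox] := boolP [exists x, p x == y].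
  rewrite raddfB qE // raddfB push_equivariant !ffunE -pE.
  have fqE x' : \sum_(x0 | p x0 == p x') f x0 = q (p x').
    by have := fq x'; rewrite ffunE.
  by rewrite !fqE subrr.
by rewrite !ffunE big1 // => x px; case/existsP: nox; exists x.
Qed.

End Push.

Section Matrices.
Variables (gT : finGroupType) (X : finType) (to : {action gT &-> X}).
Local Notation vec := {ffun X -> int}.
Local Notation mat := {ffun X * X -> int}.
Implicit Types (x y : vec) (f : mat) (i j : X).

Definition pair_act (ij : X * X) g := (to ij.1 g, to ij.2 g).

Fact pair_act1 : pair_act^~ 1%g =1 id.
Proof. by case=> i j; rewrite /pair_act !act1. Qed.

Fact pair_actM ij : act_morph pair_act ij.
Proof. by move=> g h; rewrite /pair_act !actM. Qed.

Definition pair_action : {action gT &-> X * X} := TotalAction pair_act1 pair_actM.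

(** The symmetric square of Z^X is the permutation module on the subsets of X
    with one or two elements, and the matrix unit at (i, j) is sent to the set
    of its two indices.  Using all subsets of X as index set is harmless, as the
    fibres over the other subsets are empty. *)
Definition set_of_pair (ij : X * X) : {set X} := [set ij.1; ij.2].

Lemma set_of_pair_act ij g :
  set_of_pair (pair_action ij g) = (to^*)%act (set_of_pair ij) g.
Proof. by rewrite /set_of_pair /= setactE imsetU !imset_set1. Qed.

Lemma set_of_pair_eq a b i j : (set_of_pair (a, b) == set_of_pair (i, j)) =
  ((a, b) == (i, j)) || ((a, b) == (j, i)).
Proof.
rewrite /set_of_pair /= !xpair_eqE; apply/eqP/idP => [E|].
  have: a \in [set i; j] by rewrite -E set21.
  have: b \in [set i; j] by rewrite -E set22.
  have: i \in [set a; b] by rewrite E set21.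
  have: j \in [set a; b] by rewrite E set22.
  rewrite !inE !(eq_sym i) !(eq_sym j).
  by do 4![case/orP=> /eqP ?]; subst; rewrite !eqxx ?orbT.
by case/orP=> /andP [/eqP -> /eqP ->] //; rewrite setUC.
Qed.

Definition mat_gmodule := fun_gmodule pair_action.

Definition sym_part : {additive mat_gmodule -> fun_gmodule (to^*)%act} :=
  push_hom set_of_pair pair_action (to^*)%act.

Definition row_sums : {additive mat_gmodule -> fun_gmodule to} :=
  push_hom fst pair_action to.

Definition col_sums : {additive mat_gmodule -> fun_gmodule to} :=
  push_hom snd pair_action to.

Lemma row_sumsE f i : row_sums f i = \sum_j f (i, j).
Proof.
rewrite ffunE (reindex_onto (fun j => (i, j)) snd) /=.
  by apply: eq_bigl => j; rewrite !eqxx.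
by case=> a b /= /eqP ->.
Qed.

Lemma col_sumsE f j : col_sums f j = \sum_i f (i, j).
Proof.
rewrite ffunE (reindex_onto (fun i => (i, j)) fst) /=.
  by apply: eq_bigl => i; rewrite !eqxx.
by case=> a b /= /eqP ->.
Qed.

Definition alternating f := forall i j, f (i, j) = - f (j, i).

(** Over the integers the kernel of the tensor square of Z^X onto its symmetric
    square is the exterior square. *)
Lemma sym_part_eq0 f : sym_part f = 0 <-> alternating f.
Proof.
have sE i j : sym_part f (set_of_pair (i, j)) =
    if i == j then f (i, j) else f (i, j) + f (j, i).
  rewrite ffunE (bigD1 (i, j)) //=; case: eqVneq => [<-|ij].
    rewrite big1 ?addr0 // => -[a b]; rewrite set_of_pair_eq orbb.
    by case/andP => ->.
  rewrite (bigD1 (j, i)) /=; last first.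
    by rewrite set_of_pair_eq eqxx orbT xpair_eqE negb_and eq_sym ij.
  rewrite big1 ?addr0 // => -[a b]; rewrite set_of_pair_eq.
  by move=> /andP [/andP [/orP [/eqP ->|/eqP ->]]]; rewrite eqxx.
split=> [/ffunP f0 i j|fA].
  have := f0 (set_of_pair (i, j)); rewrite sE ffunE.
  by case: eqVneq => [<- -> //|_ /eqP]; rewrite addr_eq0 => /eqP.
apply/ffunP => S; rewrite [RHS]ffunE.
have [/existsP [[i j] /eqP <-]|nox] := boolP [exists ij, set_of_pair ij == S].
  rewrite sE; case: eqVneq => [<-|_]; last by rewrite fA addNr.
  by have /eqP := fA i i; rewrite -addr_eq0 -mulr2n mulrn_eq0 => /eqP.
by rewrite ffunE big1 // => x px; case/existsP: nox; exists x.
Qed.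

Definition outer x y : mat := [ffun ij => x ij.1 * y ij.2].

Lemma outerBr x y z : outer z (x - y) = outer z x - outer z y.
Proof. by apply/ffunP => ij; rewrite !ffunE mulrBr. Qed.

Lemma outerDl x y z : outer (x + y) z = outer x z + outer y z.
Proof. by apply/ffunP => ij; rewrite !ffunE mulrDl. Qed.

Lemma outerDr x y z : outer z (x + y) = outer z x + outer z y.
Proof. by apply/ffunP => ij; rewrite !ffunE mulrDr. Qed.

Lemma outer_act x y g :
  outer (fun_act to x g) (fun_act to y g) = fun_act pair_action (outer x y) g.
Proof. by apply/ffunP => ij; rewrite !ffunE. Qed.

Lemma row_sums_outer x y i : row_sums (outer x y) i = x i * \sum_j y j.
Proof. by rewrite row_sumsE mulr_sumr; apply: eq_bigr => j _; rewrite ffunE. Qed.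

Lemma col_sums_outer x y i : col_sums (outer x y) i = (\sum_j x j) * y i.
Proof. by rewrite col_sumsE mulr_suml; apply: eq_bigr => j _; rewrite ffunE. Qed.

Definition wedge x y : mat := outer x y - outer y x.

Lemma wedge_alternating x y : alternating (wedge x y).
Proof. by move=> i j; rewrite !ffunE /=; ring. Qed.

Lemma wedge_act x y g :
  wedge (fun_act to x g) (fun_act to y g) = fun_act pair_action (wedge x y) g.
Proof. by rewrite /wedge !outer_act; apply/ffunP => ij; rewrite !ffunE. Qed.

Lemma row_sums_wedge x y i :
  row_sums (wedge x y) i = x i * \sum_j y j - y i * \sum_j x j.
Proof.
rewrite row_sumsE !mulr_sumr -sumrB.
by apply: eq_bigr => j _; rewrite !ffunE.
Qed.

Lemma row_col_alternating f : alternating f -> row_sums f + col_sums f = 0.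
Proof.
move=> fA; apply/ffunP => i; rewrite ffunE row_sumsE col_sumsE ffunE -big_split.
by rewrite big1 // => j _; rewrite /= fA addNr.
Qed.

End Matrices.

(** * The tensor square of the root lattice *)

Lemma tensor2_ext (gT : finGroupType) (M : gmodule gT) (W : zmodType)
    (f h : {additive tensor2 M -> W}) :
  (forall x y, f (tens x y) = h (tens x y)) -> f =1 h.
Proof.
move=> fh t; apply/eqP.
apply: (@tensor2_span _ M [pred t | f t == h t]) t => [|x y]; last first.
  by rewrite inE fh.
split=> [|x y]; rewrite !inE ?raddf0 // !raddfB.
by move=> /eqP -> /eqP ->.
Qed.

Section RootTensors.
Variable n : nat.
Local Notation A := (root_lattice n).
Local Notation to := (perm_action 'I_n).
Local Notation mat := (mat_gmodule to).

Fact root_diff_sum0 (i j : 'I_n) : zdelta i - zdelta j \in @sum_zero n.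
Proof.
rewrite inE (eq_bigr (fun l => zdelta i l - zdelta j l)).
  by rewrite sumrB !sum_zdelta subrr.
by move=> l _; rewrite !ffunE.
Qed.

Definition root_diff (i j : 'I_n) : A := RootVec (root_diff_sum0 i j).

Lemma root_val_inj : injective (fun x : A => root_val x).
Proof. exact: val_inj. Qed.

Lemma root_val_act (x : A) s : root_val (gact x s) = fun_act to (root_val x) s.
Proof. by []. Qed.

Lemma sum_root (x : A) : \sum_i root_val x i = 0.
Proof. by have /eqP := root_valP x. Qed.

Lemma zdelta_act i s : fun_act to (zdelta i) s = zdelta (s i).
Proof.
apply/ffunP => j; rewrite !ffunE /= /aperm.
by rewrite -{2}(permKV s j) (inj_eq perm_inj).
Qed.

Lemma root_diff_act i j s : gact (root_diff i j) s = root_diff (s i) (s j).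
Proof.
apply: root_val_inj; rewrite root_val_act /= -!zdelta_act.
by apply/ffunP => k; rewrite !ffunE.
Qed.

Lemma root_diff_add i j k : root_diff i j + root_diff j k = root_diff i k.
Proof. by apply: root_val_inj; rewrite /= addrA subrK. Qed.

Fact tensor_mx_ex : exists T : {additive tensor2 A -> mat},
  forall x y, T (tens x y) = outer (root_val x) (root_val y).
Proof.
by apply: tensor2_lift => x y z; [exact: outerDl | exact: outerDr].
Qed.

(** The embedding of the tensor square into matrices; its image consists of the
    matrices with vanishing row and column sums. *)
Definition tensor_mx := projT1 (cid tensor_mx_ex).

Lemma tensor_mxE x y : tensor_mx (tens x y) = outer (root_val x) (root_val y).
Proof. by rewrite /tensor_mx; case: cid. Qed.

Lemma tensor_mx_equivariant : equivariant tensor_mx.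
Proof.
move=> t s; move: t.
apply: (@tensor2_ext _ A _ (tensor_mx \o gact_by s) (gact_by s \o tensor_mx)).
move=> x y; rewrite -[LHS]/(tensor_mx (gact (tens x y) s)) gact_tens.
rewrite -[RHS]/(gact (tensor_mx (tens x y)) s) !tensor_mxE.
exact: (outer_act to (root_val x) (root_val y) s).
Qed.

Lemma row_sums_tensor t : row_sums to (tensor_mx t) = 0.
Proof.
move: t; apply: (@tensor2_ext _ A _ (row_sums to \o tensor_mx) \0) => x y /=.
apply/ffunP => i; rewrite tensor_mxE [LHS](row_sums_outer to) sum_root mulr0.
by rewrite ffunE.
Qed.

Lemma col_sums_tensor t : col_sums to (tensor_mx t) = 0.
Proof.
move: t; apply: (@tensor2_ext _ A _ (col_sums to \o tensor_mx) \0) => x y /=.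
apply/ffunP => i; rewrite tensor_mxE [LHS](col_sums_outer to) sum_root mul0r.
by rewrite ffunE.
Qed.

Section CupSquare.
Variable i0 : 'I_n.

(** The coboundary of the i0-th unit vector of Z^n.  That vector is not in the
    root lattice, so the class of this cocycle in H^1 of the root lattice can be
    nonzero. *)
Definition root_cocycle (s : 'S_n) : A := root_diff (s i0) i0.

Lemma root_cocycleM s t :
  root_cocycle (s * t)%g = gact (root_cocycle s) t + root_cocycle t.
Proof. by rewrite /root_cocycle root_diff_act root_diff_add permM. Qed.

Lemma root_cocycleE s :
  root_val (root_cocycle s) = fun_act to (zdelta i0) s - zdelta i0.
Proof. by rewrite zdelta_act. Qed.

Definition cup_square (s t : 'S_n) : tensor2 A :=
  tens (gact (root_cocycle s) t) (root_cocycle t).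

Lemma cup_square_cocycle2 (K : {set 'S_n}) : cocycle2 K cup_square.
Proof.
move=> h k l _ _ _; rewrite /cup_square gact_tens (root_cocycleM k l).
rewrite root_cocycleM gactD tensDl tensDr -gactM.
by rewrite addrA.
Qed.

(** When c fixes j, the cocycle is on <[c]> the coboundary of the root
    e_i0 - e_j, which has coordinate sum zero, and the cup product of a cocycle
    with a coboundary is a coboundary. *)
Lemma cup_square_splits (c : 'S_n) j :
  c j = j -> splits_on <[c]>%g cup_square.
Proof.
move=> cj; have fixj s : s \in <[c]>%g -> s j = j.
  move=> sc; have : s \in ('C[j | to])%g.
    apply: subsetP s sc; rewrite cycle_subG; exact/astab1P.
  by move/astab1P.
exists (fun s => tens (root_cocycle s) (root_diff i0 j)) => h k hC kC.
rewrite /diff1 root_cocycleM tensDl gact_tens (root_diff_act i0 j) fixj //.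
rewrite opprD addrACA subrr addr0.
have -> : root_diff (k i0) j = root_cocycle k + root_diff i0 j.
  by rewrite root_diff_add.
by rewrite tensDr addrK.
Qed.

(** The obstruction.  The cup square is also the coboundary of
    v s = (root_cocycle s) (x) e, with e the i0-th unit vector, in a larger
    lattice.  If t split it modulo alternating matrices, t - v would be a cocycle
    in the symmetric square of Z^n, hence the coboundary of some f.  Adding up
    the row sums and the column sums, which kills alternating matrices and t,
    shows that e + row_sums f + col_sums f is fixed by H.  But its coordinate
    sum is 1 plus twice the sum of the entries of f. *)
Lemma cup_square_not_sym_split (H : {group 'S_n}) (t : 'S_n -> mat) :
    (forall w : {ffun 'I_n -> int}, {in H, forall s, fun_act to w s = w} ->
      (2 %| \sum_i w i)%Z) ->
    {in H, forall s, row_sums to (t s) = 0 /\ col_sums to (t s) = 0} ->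
  ~ {in H &, forall h k,
       sym_part to (diff1 t h k - tensor_mx (cup_square h k)) = 0}.
Proof.
move=> Heven tsum tsym.
pose e : {ffun 'I_n -> int} := zdelta i0.
have se : \sum_i e i = 1 := sum_zdelta i0.
pose a s := root_val (root_cocycle s).
have aM s u : a (s * u)%g = fun_act to (a s) u + a u.
  by rewrite /a root_cocycleM.
pose v s : mat := outer (a s) e.
have dv h k : diff1 v h k = tensor_mx (cup_square h k).
  rewrite /diff1 /v -[gact _ k](outer_act to (a h) e k) aM.
  rewrite (outerDl (fun_act to (a h) k)) opprD addrACA subrr addr0 -outerBr.
  by rewrite tensor_mxE root_val_act (root_cocycleE k).
have [h k hH kH|f fE] := @push_cocycle1_lift _ _ (@set_of_pair 'I_n) _
    (pair_action to) (to^*)%act (set_of_pair_act to) H (fun s => t s - v s).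
  by rewrite diff1B dv; exact: tsym.
pose w : {ffun 'I_n -> int} := e + (row_sums to f + col_sums to f).
have wH s : s \in H -> fun_act to w s = w.
  move=> sH; have /sym_part_eq0/(row_col_alternating to) := fE s sH.
  have [ts1 ts2] := tsum s sH.
  have rv : row_sums to (v s) = a s.
    by apply/ffunP => i; rewrite [LHS](row_sums_outer to) se mulr1.
  have cv : col_sums to (v s) = 0.
    by apply/ffunP => i; rewrite [LHS](col_sums_outer to) sum_root mul0r ffunE.
  have lin (F : {additive mat -> fun_gmodule to}) x y u z :
      F (x - y - (u - z)) = F x - F y - (F u - F z) by rewrite !(raddfB F).
  rewrite /diff0 !lin ts1 ts2 rv cv.
  rewrite [row_sums to (gact _ _)]push_equivariant //.
  rewrite [col_sums to (gact _ _)]push_equivariant //.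
  rewrite /w /a root_cocycleE -/e.
  move: (row_sums to f) (col_sums to f) => r c /ffunP E.
  apply/ffunP => i; have := E i; rewrite !ffunE => {}E.
  by apply/eqP; rewrite -subr_eq0 -oppr_eq0 -[X in _ == X]E; apply/eqP; ring.
have := Heven w wH; rewrite (eq_bigr (fun i => e i + (row_sums to f i + col_sums to f i))).
  rewrite !big_split /= !sum_push se -mulr2n.
  by move/dvdzP => [m]; lia.
by move=> i _; rewrite !ffunE.
Qed.

End CupSquare.
End RootTensors.

(** * The exterior and symmetric squares of the root lattice *)

Lemma sum_pairs_ltn (n : nat) (V : zmodType) (F : 'I_n * 'I_n -> V) :
    (forall i, F (i, i) = 0) ->
  \sum_p F p = \sum_(p : 'I_n * 'I_n | (p.1 < p.2)%N) (F p + F (p.2, p.1)).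
Proof.
move=> F0; rewrite (bigID (fun p : 'I_n * 'I_n => (p.1 < p.2)%N)) /=.
rewrite big_split /=; congr (_ + _).
rewrite (bigID (fun p : 'I_n * 'I_n => p.1 == p.2)) /= big1 ?add0r.
  pose swap (p : 'I_n * 'I_n) := (p.2, p.1).
  have swapK : involutive swap by move=> [i j].
  rewrite (reindex_inj (inv_inj swapK)) /=; apply: eq_bigl => -[i j] /=.
  by rewrite -leqNgt ltn_neqAle andbC -val_eqE eq_sym.
by move=> [i j] /= /andP [_ /eqP ->].
Qed.

Section ExteriorSquare.
Variable n : nat.
Local Notation A := (root_lattice n).
Local Notation to := (perm_action 'I_n).
Local Notation mat := (mat_gmodule to).

Definition sym_proj : {additive tensor2 A -> sym2 A} := gen_proj (@sym_rel _ A).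
Definition alt_proj : {additive tensor2 A -> alt2 A} := gen_proj (@alt_rel _ A).

Lemma sym_proj_equivariant : equivariant sym_proj.
Proof. by move=> t s; rewrite [RHS]quot_act_proj //; exact: sym_rel_stable. Qed.

Lemma alt_proj_equivariant : equivariant alt_proj.
Proof. by move=> t s; rewrite [RHS]quot_act_proj //; exact: alt_rel_stable. Qed.

Lemma sym_part_tensor_eq0 (t : tensor2 A) :
  sym_proj t = 0 -> sym_part to (@tensor_mx n t) = 0.
Proof.
move=> t0; apply: (@gen_subgroup_ker _ (@sym_rel _ A) _ (sym_part to \o @tensor_mx n)).
  move=> _ [x y]; rewrite /= raddfB !tensor_mxE; apply/(sym_part_eq0 to).
  exact: wedge_alternating.
by rewrite -[t]subr0; apply/gen_proj_eq; rewrite [LHS]t0 raddf0.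
Qed.

Lemma alt_proj_diag x : alt_proj (tens x x) = 0.
Proof.
rewrite -(raddf0 alt_proj); apply/gen_proj_eq; rewrite subr0.
by apply: mem_gen_subgroup; exact: AltRel.
Qed.

Lemma alt_projC x y : alt_proj (tens x y) = - alt_proj (tens y x).
Proof.
have := alt_proj_diag (x + y); rewrite tensDl !tensDr !raddfD !alt_proj_diag.
by rewrite add0r addr0 => /eqP; rewrite addr_eq0 => /eqP.
Qed.

Lemma alt2_ext (W : zmodType) (f h : {additive alt2 A -> W}) :
  (forall x y, f (alt_proj (tens x y)) = h (alt_proj (tens x y))) -> f =1 h.
Proof.
move=> fh q; have [t <-] := gen_proj_surj q.
by move: t; apply: (@tensor2_ext _ A _ (f \o alt_proj) (h \o alt_proj)).
Qed.

Fact wedge_mx_ex : exists T : {additive alt2 A -> mat},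
  forall x y, T (alt_proj (tens x y)) = wedge (root_val x) (root_val y).
Proof.
have [|x y z|T0 T0E] := @tensor2_lift _ A mat (fun x y => wedge (root_val x) (root_val y)).
- move=> x y z; rewrite /wedge /= outerDl outerDr opprD addrACA //.
- by rewrite /wedge /= outerDl outerDr opprD addrACA.
have [|T TE] := @gen_quot_lift _ (@alt_rel _ A) _ T0.
  by move=> _ [x]; rewrite T0E /wedge subrr.
by exists T => x y; rewrite [LHS]TE T0E.
Qed.

Definition wedge_mx := projT1 (cid wedge_mx_ex).

Lemma wedge_mxE x y :
  wedge_mx (alt_proj (tens x y)) = wedge (root_val x) (root_val y).
Proof. by rewrite /wedge_mx; case: cid. Qed.

Lemma wedge_mx_equivariant : equivariant wedge_mx.
Proof.
move=> q s; move: q.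
apply: (@alt2_ext _ (wedge_mx \o gact_by s) (gact_by s \o wedge_mx)) => x y.
rewrite -[LHS]/(wedge_mx (gact (alt_proj (tens x y)) s)).
rewrite -[RHS]/(gact (wedge_mx (alt_proj (tens x y))) s).
rewrite -alt_proj_equivariant gact_tens !wedge_mxE.
exact: (wedge_act to (root_val x) (root_val y) s).
Qed.

Lemma sym_part_wedge q : sym_part to (wedge_mx q) = 0.
Proof.
move: q; apply: (@alt2_ext _ (sym_part to \o wedge_mx) \0) => x y /=.
by apply/(sym_part_eq0 to); rewrite wedge_mxE; exact: wedge_alternating.
Qed.

Lemma row_sums_wedge_mx q : row_sums to (wedge_mx q) = 0.
Proof.
move: q; apply: (@alt2_ext _ (row_sums to \o wedge_mx) \0) => x y /=.
apply/ffunP => i; rewrite wedge_mxE [LHS](row_sums_wedge to) !sum_root.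
by rewrite !mulr0 subrr ffunE.
Qed.

Variable i0 : 'I_n.
Local Notation d i := (root_diff i i0).

Lemma root_comb (x : A) : x = zcomb (fun i => d i) (root_val x).
Proof.
apply: root_val_inj => /=.
pose V : {additive A -> {ffun 'I_n -> int}} := val.
have VE z : V z = root_val z by [].
rewrite -!VE /zcomb raddf_sum; apply/ffunP => j; rewrite sum_ffunE.
rewrite (eq_bigr (fun i => (i == j)%:Z * root_val x i - (i0 == j)%:Z * root_val x i)).
  rewrite sumrB -mulr_sumr sum_root mulr0 subr0.
  rewrite (bigD1 j) //= eqxx mul1r big1 ?addr0 // => i /negbTE ->.
  by rewrite mul0r.
by move=> i _; rewrite raddfMz ffunMzE !ffunE -mulrzr intz mulrBl.
Qed.

(** Alternating u equals the sum of u_ij e_i ^ e_j over i < j; when its row sums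
    vanish, each e_i may be replaced by the root e_i - e_i0. *)
Definition unwedge (u : mat) : alt2 A :=
  \sum_(p : 'I_n * 'I_n | (p.1 < p.2)%N)
     alt_proj (tens (d p.1) (d p.2)) *~ (u : {ffun _ -> _}) p.

Fact unwedge_additive : zmod_morphism unwedge.
Proof.
move=> u v; rewrite /unwedge -sumrB; apply: eq_bigr => p _.
by rewrite !ffunE mulrzBr.
Qed.
HB.instance Definition _ :=
  GRing.isZmodMorphism.Build mat (alt2 A) unwedge unwedge_additive.

Lemma wedge_mxK : cancel wedge_mx unwedge.
Proof.
apply: (@alt2_ext _ (unwedge \o wedge_mx) idfun) => x y /=.
rewrite wedge_mxE {2}(root_comb x) {2}(root_comb y).
rewrite (sum_biadditive _ _ _ (@tensDl _ A) (@tensDr _ A)) pair_bigA.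
rewrite raddf_sum sum_pairs_ltn /= => [|i]; last first.
  by rewrite raddfMz alt_proj_diag mul0rz.
apply: eq_bigr => -[i j] _; rewrite !raddfMz (alt_projC (d j)) mulNrz -mulrzBr.
by rewrite !ffunE /= [root_val x j * _]mulrC.
Qed.

Lemma unwedgeK (u : mat) :
  alternating u -> row_sums to u = 0 -> wedge_mx (unwedge u) = u.
Proof.
move=> uA u0.
have rows i : \sum_j u (i, j) = 0 by rewrite -(row_sumsE to) u0 ffunE.
have cols j : \sum_i u (i, j) = 0.
  have -> : \sum_i u (i, j) = \sum_i - u (j, i) by apply: eq_bigr => i _; exact: uA.
  by rewrite sumrN rows oppr0.
transitivity (\sum_p outer (root_val (d p.1)) (root_val (d p.2)) *~ u p).
  rewrite sum_pairs_ltn => [|i]; last first.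
    have /eqP := uA i i; rewrite -addr_eq0 -mulr2n mulrn_eq0 => /eqP ->.
    by rewrite mulr0z.
  rewrite raddf_sum; apply: eq_bigr => -[i j] _ /=.
  by rewrite raddfMz wedge_mxE (uA j) mulrNz -mulrzBl.
apply/ffunP => -[k l]; rewrite sum_ffunE.
(* The coordinates of e_i - e_i0 act as those of e_i on vectors of sum zero. *)
have pick_sum (F : 'I_n -> int) m :
    \sum_i F i = 0 -> \sum_i root_val (d i) m * F i = F m.
  move=> F0.
  rewrite (eq_bigr (fun i => (i == m)%:Z * F i - (i0 == m)%:Z * F i)).
    rewrite sumrB -mulr_sumr F0 mulr0 subr0.
    by rewrite (bigD1 m) //= eqxx mul1r big1 ?addr0 // => i /negbTE ->; rewrite mul0r.
  by move=> i _; rewrite !ffunE mulrBl.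
transitivity (\sum_i \sum_j
    root_val (d i) k * (root_val (d j) l * u (i, j))).
  rewrite pair_bigA; apply: eq_bigr => -[i j] _.
  by rewrite ffunMzE ffunE /= -mulrzr intz mulrA.
rewrite -(pick_sum (fun i => u (i, l)) k (cols l)); apply: eq_bigr => i _.
by rewrite -mulr_sumr (pick_sum (fun j => u (i, j)) l (rows i)).
Qed.

(** The exterior square of the root lattice is the lattice of alternating
    matrices with vanishing row sums. *)
Lemma wedge_mx_retract : exists r : {additive mat -> alt2 A},
  cancel wedge_mx r /\ forall u : mat, alternating u -> row_sums to u = 0 ->
                        wedge_mx (r u) = u.
Proof. by exists unwedge; split; [exact: wedge_mxK | exact: unwedgeK]. Qed.

(** Alternating matrices are the kernel of a map of permutation modules, so phi
    splits there, say by g2.  The obstruction to splitting it within the exterior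
    square of the root lattice lies in H^1 of the root lattice: it is the class of
    the row sums of g2, the coboundary of some u.  That class is a multiple of
    the class of the coboundary of the unit vector e = e_i0, by the factor
    c = sum of u.  As i0 moves at most to i1, the wedges e k ^ e form a cocycle
    eta of alternating matrices with row sums e k - e; subtracting c times eta
    removes the obstruction. *)
Lemma alt2_sha2_trivial (H : {group 'S_n}) (i1 : 'I_n) :
    {in H, forall s : 'S_n, s i0 = i0 \/ s i0 = i1} ->
  sha2_trivial (alt2 A) H.
Proof.
move=> orb phi phiH phiC.
have [c cH|g gE] := fun_gmodule_sha2 (cocycle2_map wedge_mx_equivariant phiH).
  exact/(splits_on_map wedge_mx_equivariant)/phiC.
have [h k hH kH|f fE] := @push_cocycle1_lift _ _ (@set_of_pair 'I_n) _
    (pair_action to) (to^*)%act (set_of_pair_act to) H g.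
  by rewrite -gE //; exact: sym_part_wedge.
pose g2 k := g k - diff0 f k.
have g2E : {in H &, forall h k, diff1 g2 h k = wedge_mx (phi h k)}.
  by move=> h k hH kH; rewrite diff1B diff1_diff0 subr0 gE.
have rowE : equivariant (row_sums to) by exact: push_equivariant.
have [h k hH kH|u uE] :=
    @fun_gmodule_cocycle1 _ _ to H (fun k => row_sums to (g2 k)).
  by rewrite (diff1_map rowE) g2E // row_sums_wedge_mx.
pose e : {ffun 'I_n -> int} := zdelta i0.
have se : \sum_i e i = 1 := sum_zdelta i0.
pose c := \sum_i u i.
pose eta (k : 'S_n) : mat := wedge (fun_act to e k) e.
pose we : mat := wedge u e.
pose g3 k : mat := g2 k - diff0 we k - eta k *~ c.
(* Of the three vectors e h k, e k and e two coincide, so that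
   e h k ^ e k + e k ^ e = e h k ^ e. *)
have etaZ : {in H &, forall h k, diff1 eta h k = 0}.
  move=> h k hH kH.
  rewrite /diff1 -[gact _ k](wedge_act to (fun_act to e h) e k) -fun_actM.
  have wedge0 (x y z : {ffun 'I_n -> int}) : [\/ x = y, y = z | x = z] ->
      wedge x y + wedge y z - wedge x z = 0.
    by case=> ->; apply/ffunP => ij; rewrite !ffunE; ring.
  apply: wedge0; rewrite -/e !zdelta_act permM /e.
  have kE := orb k kH; have := orb (h * k)%g (groupM hH kH); rewrite permM => hkE.
  case: kE => ->; first by constructor 2.
  by case: hkE => ->; [constructor 3 | constructor 1].
have g3row k : k \in H -> row_sums to (g3 k) = 0.
  move=> kH; rewrite /g3 (raddfB _ (g2 k - _)) (raddfB _ (g2 k)) uE // raddfMz.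
  rewrite -(diff0_map rowE).
  have -> : row_sums to we = u - e *~ c.
    apply/ffunP => i; rewrite [LHS](row_sums_wedge to) se mulr1.
    by rewrite !(ffunE, ffunMzE) -mulrzr intz.
  have -> : row_sums to (eta k) = fun_act to e k - e.
    apply/ffunP => i; rewrite [LHS](row_sums_wedge to) sum_fun_act se !mulr1.
    by rewrite !ffunE.
  rewrite -[_ - e]/(diff0 (e : fun_gmodule to) k).
  have -> : diff0 (u - e *~ c : fun_gmodule to) k =
      diff0 u k - diff0 (e : fun_gmodule to) k *~ c.
    rewrite /diff0 gactB gactMz mulrzBl !opprB !addrA.
    by rewrite [LHS](ACl (1*4*3*2)).
  by rewrite subKr subrr.
have g3sym k : k \in H -> sym_part to (g3 k) = 0.
  move=> kH; rewrite /g3 (raddfB _ (g2 k - _)) (raddfB _ (g2 k)) raddfMz.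
  have -> : sym_part to (g2 k) = 0 by exact: fE.
  have symE : equivariant (sym_part to).
    exact: (push_equivariant (set_of_pair_act to)).
  have symW x y : sym_part to (wedge x y) = 0.
    by apply/(sym_part_eq0 to); exact: wedge_alternating.
  by rewrite -(diff0_map symE) !symW /diff0 gact0 mul0rz !subrr.
have [r [rK rE]] := wedge_mx_retract.
have g3E k : k \in H -> wedge_mx (r (g3 k)) = g3 k.
  by move=> kH; apply: rE; [exact/(sym_part_eq0 to)/g3sym | exact: g3row].
exists (fun k => r (g3 k)) => h k hH kH; apply: (can_inj rK).
transitivity (diff1 g3 h k); last first.
  by rewrite -[RHS](diff1_map wedge_mx_equivariant); apply/esym/(eq_diff1 g3E).
rewrite (diff1B (fun l => g2 l - diff0 we l)) (diff1B g2) diff1_diff0 subr0 g2E //.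
by rewrite {1}/diff1 gactMz -mulrzDl -mulrzBl -/(diff1 eta h k) etaZ // mul0rz subr0.
Qed.

Lemma cup_square_locally_split (H : {group 'S_n}) :
    {in H, forall s : 'S_n, exists j, s j = j} ->
  {in H, forall c, splits_on <[c]>%g (cup_square i0)}.
Proof. by move=> fixH c /fixH [j /cup_square_splits]. Qed.

Variable H : {group 'S_n}.
Hypotheses (fixH : {in H, forall s : 'S_n, exists j, s j = j})
  (evenH : forall w : {ffun 'I_n -> int},
     {in H, forall s, fun_act to w s = w} -> (2 %| \sum_i w i)%Z).

Lemma sym2_sha2_nontrivial : ~ sha2_trivial (sym2 A) H.
Proof.
move=> sha; have locC := cup_square_locally_split fixH.
have cocC := @cup_square_cocycle2 n i0 H.
have [c cH|g gE] := sha _ (cocycle2_map sym_proj_equivariant cocC).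
  exact/(splits_on_map sym_proj_equivariant)/locC.
pose t k := projT1 (cid (gen_proj_surj (g k))).
have tE k : sym_proj (t k) = g k by rewrite /t; case: cid.
apply: (@cup_square_not_sym_split _ i0 H (fun k => @tensor_mx n (t k)) evenH).
  by move=> s _; rewrite row_sums_tensor col_sums_tensor.
move=> h k hH kH; rewrite (diff1_map (@tensor_mx_equivariant n)) -raddfB.
apply: sym_part_tensor_eq0; rewrite raddfB gE // -(diff1_map sym_proj_equivariant).
by rewrite /diff1 !tE subrr.
Qed.

Lemma tensor2_sha2_nontrivial : ~ sha2_trivial (tensor2 A) H.
Proof.
move=> sha; have [g gE] :=
  sha _ (@cup_square_cocycle2 n i0 H) (cup_square_locally_split fixH).
apply: (@cup_square_not_sym_split _ i0 H (fun k => @tensor_mx n (g k)) evenH).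
  by move=> s _; rewrite row_sums_tensor col_sums_tensor.
move=> h k hH kH; rewrite (diff1_map (@tensor_mx_equivariant n)) gE //.
by rewrite subrr raddf0.
Qed.

End ExteriorSquare.

(** * A Klein four-group of permutations *)

Section KleinFour.
Variable n : nat.
Hypothesis n_even : ~~ odd n.

Definition partner (i : nat) : nat := if odd i then i.-1 else i.+1.

Lemma partnerK : involutive partner.
Proof.
by case=> // i; rewrite /partner /=; case oi: (odd i) => /=; rewrite ?oi.
Qed.

Lemma partner_lt (i : 'I_n) : (partner i < n)%N.
Proof. by have := ltn_ord i; rewrite /partner; case: ifP => oi; lia. Qed.

Definition ord_partner (i : 'I_n) : 'I_n := Ordinal (partner_lt i).

Lemma ord_partnerK : involutive ord_partner.
Proof. by move=> i; apply/val_inj; exact: partnerK. Qed.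

(** The letters are paired as 0-1, 2-3, 4-5 and so on.  The element p of
    (Z/2)^2 swaps the first pair according to the character p.1, the second
    according to p.1 + p.2 and all others according to p.2.  Every nonzero
    character is used, so each element is killed by one of them and has fixed
    letters, while no letter is fixed by the whole group. *)
Definition moves (p : bool * bool) (i : nat) : bool :=
  if (i < 2)%N then p.1 else if (i < 4)%N then p.1 (+) p.2 else p.2.

Lemma moves_partner p i : moves p (partner i) = moves p i.
Proof.
have E (m : nat) : ~~ odd m -> (partner i < m)%N = (i < m)%N.
  by move=> om; rewrite /partner; case: ifP => oi; apply/idP/idP; lia.
by rewrite /moves !E.
Qed.

Definition klein_fun p (i : 'I_n) := if moves p i then ord_partner i else i.

Lemma klein_funM p q i :
  klein_fun q (klein_fun p i) = klein_fun (p.1 (+) q.1, p.2 (+) q.2) i.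
Proof.
have -> : klein_fun (p.1 (+) q.1, p.2 (+) q.2) i =
    if moves p i (+) moves q i then ord_partner i else i.
  rewrite /klein_fun; congr (if _ then _ else _).
  by rewrite /moves /=; do 2!case: ifP => // _; rewrite addbACA.
rewrite /klein_fun; case mp: (moves p i); last by case: (moves q i).
by rewrite moves_partner; case: (moves q i); rewrite ?ord_partnerK.
Qed.

Lemma klein_fun1 i : klein_fun (false, false) i = i.
Proof. by rewrite /klein_fun /moves /= !if_same. Qed.

Lemma klein_fun_inj p : injective (klein_fun p).
Proof. by apply: (can_inj (g := klein_fun p)) => i; rewrite klein_funM !addbb klein_fun1. Qed.

Definition klein_perm p : 'S_n := perm (@klein_fun_inj p).

Definition klein_set : {set 'S_n} := [set klein_perm p | p : bool * bool].

Fact klein_group_set : group_set klein_set.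
Proof.
apply/group_setP; split=> [|_ _ /imsetP [p _ ->] /imsetP [q _ ->]].
  apply/imsetP; exists (false, false) => //.
  by apply/permP => i; rewrite perm1 permE klein_fun1.
apply/imsetP; exists (p.1 (+) q.1, p.2 (+) q.2) => //.
by apply/permP => i; rewrite permM !permE klein_funM.
Qed.

Definition klein_four : {group 'S_n} := Group klein_group_set.

Lemma klein_four_fixes : (6 <= n)%N ->
  {in klein_four, forall s : 'S_n, exists j, s j = j}.
Proof.
move=> n_ge6; have lt6 i : (i < 6)%N -> (i < n)%N by move/leq_trans; exact.
move=> _ /imsetP [[a b] _ ->]; case: a; case: b.
- exists (Ordinal (lt6 2%N isT)); rewrite permE //.
- exists (Ordinal (lt6 4%N isT)); rewrite permE //.
- exists (Ordinal (lt6 0%N isT)); rewrite permE //.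
- exists (Ordinal (lt6 0%N isT)); rewrite permE //.
Qed.

(** Some element swaps i with its partner, so an invariant vector takes equal
    values on each pair. *)
Lemma klein_four_even (w : {ffun 'I_n -> int}) :
  {in klein_four, forall s, fun_act (perm_action 'I_n) w s = w} ->
  (2 %| \sum_i w i)%Z.
Proof.
move=> wH.
have wE i : w (ord_partner i) = w i.
  have [p mp] : exists p, moves p i.
    rewrite /moves; case: (i < 2)%N; first by exists (true, true).
    by case: (i < 4)%N; [exists (true, false) | exists (true, true)].
  have pH : klein_perm p \in klein_four by exact: imset_f.
  have := wH _ pH => /ffunP /(_ (ord_partner i)); rewrite ffunE /= /aperm => <-.
  congr (w _); apply: (@perm_inj _ (klein_perm p)); rewrite permKV permE.
  by rewrite /klein_fun mp.
rewrite (bigID (fun i : 'I_n => odd i)) /=.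
rewrite [X in X + _](reindex_inj (inv_inj ord_partnerK)) /=.
rewrite (eq_big (fun i : 'I_n => ~~ odd i) (fun i => w i)) => [|i|i _]; last 2 first.
- by rewrite /partner; case: ifP => oi; lia.
- exact: wE.
by apply/dvdzP; exists (\sum_(i < n | ~~ odd i) w i); rewrite mulr_natr mulr2n.
Qed.

Lemma klein_four_orbit0 (i0 i1 : 'I_n) : val i0 = 0%N -> val i1 = 1%N ->
  {in klein_four, forall s : 'S_n, s i0 = i0 \/ s i0 = i1}.
Proof.
move=> i00 i11 _ /imsetP [p _ ->]; rewrite permE /klein_fun.
case: ifP => _; [right | by left].
by apply: val_inj; rewrite /= i00 i11.
Qed.

End KleinFour.

Theorem lemma4p5 (n : nat) (n_ge6 : (6 <= n)%N) (n_even : ~~ odd n) :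
  (~ exists N Q : glattice 'S_n,
       [/\ quasi_permutation Q, direct_summand N Q
         & lat_equiv (sym2_lattice (root_lattice n)) N])
  /\ ~ lat_equiv (alt2_lattice (root_lattice n))
                 (tensor2_lattice (root_lattice n)).
Proof.
pose H := klein_four n_even.
pose i0 := Ordinal (leq_trans (isT : 0 < 6)%N n_ge6).
pose i1 := Ordinal (leq_trans (isT : 1 < 6)%N n_ge6).
have fixH : {in H, forall s : 'S_n, exists j, s j = j} by exact: klein_four_fixes.
have evenH := @klein_four_even n n_even; rewrite -/H in evenH.
split.
  move=> [N [Q [qQ NQ /(sha2_equiv H) symN]]].
  apply: (sym2_sha2_nontrivial i0 fixH evenH).
  exact/symN/(sha2_summand NQ)/sha2_quasi_permutation.
move=> /(sha2_equiv H) [altT _].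
apply: (tensor2_sha2_nontrivial i0 fixH evenH); apply: altT.
exact: (@alt2_sha2_trivial n i0 H i1 (klein_four_orbit0 _ _)).
Qed.
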